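(* Suppose that the fidelity function $\mathcal H$ is coercive in the sense that $$\frac C\lambda\|v-f\|_{\mathcal Y}^\lambda\le\mathcal H(v\mid f)\quad\text{for all }v,f\in\mathcal Y,$$ where $\lambda\ge1$ and $C>0$ are constants, normalised so that $C=1$. Assume that (i) $\mathcal J:\mathcal X\to[0,+\infty]$ is proper, convex, weakly-* lower semicontinuous with weakly-* sequentially compact non-empty sublevel sets; (ii) $\mathcal H:\mathcal Y\times\mathcal Y\to[0,+\infty]$ is proper, convex in its first argument, weakly-* lower semicontinuous jointly in both arguments, and $\mathcal H(v\mid f)=0$ iff $v=f$; (iii) $A,A^l_n,A^u_n:\mathcal X\to\mathcal Y$ are weak-* to weak-* continuous; (iv) there exists $\mu^\dagger\in\mathcal Y^*\times\mathcal Y^*$, $\mu^\dagger\ge0$, with $p^\dagger:=-B^*\mu^\dagger\in\partial\mathcal J(u^\dagger_{\mathcal J})$; (v) $A^l_n\le A\le A^u_n$ for all $n$, $\|A^u_n-A^l_n\|\le\eta_n\to0$, $\mathcal H(\bar f\mid f_n)\le\delta_n\to0$, $\alpha_n\to0$. Let $(u_n,v_n)$ solve $$\min_{u\in\mathcal X,\ v\in\mathcal Y}\frac1{\alpha_n}\mathcal H(v\mid f_n)+\mathcal J(u)\quad\text{subject to}\quad A^l_nu\le v\le A^u_nu.$$ Then $$D^{p^\dagger}_{\mathcal J}(u_n,u^\dagger_{\mathcal J})=\begin{cases}O\left(\frac{\delta_n}{\alpha_n}+\alpha_n^{\frac1{\lambda-1}}+\delta_n^{\frac1\lambda}+\eta_n\right),&\lambda>1,\\[4pt]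 O\left(\frac{\delta_n}{\alpha_n}+\delta_n+\eta_n\right),&\lambda=1.\end{cases}$$ If $\alpha_n$ is chosen such that $\alpha_n\sim\delta_n^{\frac{\lambda-1}{\lambda}}$ when $\lambda>1$, and (instead of $\alpha_n\to0$) $\alpha_n=\mathrm{const}\le\frac1{\|E^*\mu^\dagger\|}$ when $\lambda=1$, then $$D^{p^\dagger}_{\mathcal J}(u_n,u^\dagger_{\mathcal J})=O\left(\delta_n^{\frac1\lambda}+\eta_n\right).$$ If $\mathcal Y$ is an AM-space with unit $\mathbf 1$ (and the strict feasibility condition stated in the context holds), the same rate holds for the symmetric Bregman distance $D^{\mathrm{symm}}_{\mathcal J}(u_n,u^\dagger_{\mathcal J})$.
   Context: $\mathcal X=\mathcal U^*$ and $\mathcal Y=\mathcal V^*$ are duals of Banach lattices with the dual norm and dual partial order ($y\ge0$ iff $\langle y,v\rangle\ge0$ for all $v\in\mathcal V$, $v\ge0$); orders on products are componentwise. $A:\mathcal X\to\mathcal Y$ is bounded linear and regular (difference of two positive operators), $A^l_n,A^u_n$ bounded linear, $A^l_n\le A\le A^u_n$ means $A^l_nu\le Au\le A^u_nu$ for all $u\ge0$. $\bar f,f_n\in\mathcal Y$, $\alpha_n>0$. $u^\dagger_{\mathcal J}\ge0$ satisfies $Au^\dagger_{\mathcal J}=\bar f$ and $\mathcal J(u^\dagger_{\mathcal J})\le\mathcal J(u)$ whenever $Au=\bar f$. $Bu=(Au,-Au)$, $B_nu=(A^l_nu,-A^u_nu)$, $Ev=(v,-v)$. For $p\in\partial\mathcal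 J(w)$: $D^p_{\mathcal J}(u,w)=\mathcal J(u)-\mathcal J(w)-\langle p,u-w\rangle$; for $q\in\partial\mathcal J(u)$, $p\in\partial\mathcal J(w)$: $D^{\mathrm{symm}}_{\mathcal J}(u,w)=\langle q-p,u-w\rangle$. $a_n\sim b_n$ means $a_n/b_n$ is bounded above and below by positive constants. For the symmetric statement the subgradients are $p^\dagger$ and $p_n=-B_n^*\mu_n\in\partial\mathcal J(u_n)$, where $\mu_n$ solves the dual problem $\sup_{\mu\in\mathcal Y^*\times\mathcal Y^*,\mu\ge0}-\frac1{\alpha_n}\mathcal H^*(\alpha_nE^*\mu\mid f_n)-\mathcal J^*(-B_n^*\mu)$ (conjugates; $\mathcal H^*$ in the first argument), and the strict feasibility condition is: for every $n$ there are $u_0\in\operatorname{dom}\mathcal J$, $v_0\in\operatorname{dom}\mathcal H(\cdot\mid f_n)$, $\varepsilon>0$ with $A^l_nu_0+\varepsilon\mathbf 1\le v_0\le A^u_nu_0-\varepsilon\mathbf 1$. A Banach lattice is an AM-space if $\|x\vee y\|=\|x\|\vee\|y\|$ for $x,y\ge0$; a unit is $\mathbf 1\ge0$ with $\|\mathbf 1\|=1$ and $\|x\|\le1\Rightarrow|x|\le\mathbf 1$. *)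

(* Defs.v *)
From HB Require Import structures.
From mathcomp Require Import all_boot all_order all_algebra.
From mathcomp Require Import ring lra.
From mathcomp Require Import all_classical all_reals all_analysis.

Set Implicit Arguments.
Unset Strict Implicit.
Unset Printing Implicit Defensive.

Import Order.TTheory GRing.Theory Num.Theory.
Import numFieldNormedType.Exports.

Local Open Scope classical_set_scope.
Local Open Scope ring_scope.

Section bounded_linear.
Variables (R : realType) (E F : normedModType R).

Definition bounded_linear : {pred (E -> F)} :=
  [pred f : E -> F |
    `[< linear f /\ exists M : R, forall x, `|f x| <= M * `|x| >]].

Record boundedLinear :=
  BoundedLinear { blin_fun :> E -> F ; _ : blin_fun \in bounded_linear }.

HB.instance Definition _ := [isSub for blin_fun].
HB.instance Definition _ := [Choice of boundedLinear by <:].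

Lemma bounded_linearP (f : E -> F) :
  reflect (linear f /\ exists M : R, forall x, `|f x| <= M * `|x|)
          (f \in bounded_linear).
Proof. exact: asboolP. Qed.

Lemma bounded_linear_submod_closed : submod_closed bounded_linear.
Proof.
split=> [|a f g /bounded_linearP[lf [M Mf]] /bounded_linearP[lg [N Ng]]].
  apply/bounded_linearP; split=> [b x y|]; first by rewrite scaler0 addr0.
  by exists 0 => x; rewrite normr0 mul0r.
apply/bounded_linearP; split=> [b x y|].
  rewrite !fctE lf lg !scalerDr !scalerA mulrC -!addrA; congr (_ + _).
  by rewrite addrCA.
exists (`|a| * M + N) => x; rewrite mulrDl (le_trans (ler_normD _ _))//.
by rewrite lerD// normrZ -mulrA ler_wpM2l.
Qed.

HB.instance Definition _ := GRing.isSubmodClosed.Build R (E -> F)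
  bounded_linear bounded_linear_submod_closed.
HB.instance Definition _ := [SubChoice_isSubLmodule of boundedLinear by <:].

Fact blin_is_linear (f : boundedLinear) : linear f.
Proof. by case: f => f /= /bounded_linearP[]. Qed.
HB.instance Definition _ (f : boundedLinear) :=
  GRing.isLinear.Build R E F *:%R f (blin_is_linear f).

Lemma blinP (f g : boundedLinear) : f =1 g -> f = g.
Proof. by move=> fg; apply: val_inj; apply/funext. Qed.

Lemma blin_bounded (f : boundedLinear) :
  exists M : R, forall x, `|f x| <= M * `|x|.
Proof. by case: f => f /= /bounded_linearP[]. Qed.

Implicit Types (f g : boundedLinear) (x : E).

Definition op_norm (f : boundedLinear) : R :=
  sup [set `|f x| | x in [set x | `|x| <= 1]].

Lemma op_norm_has_sup (f : boundedLinear) : has_sup [set `|f x| | x in [set x | `|x| <= 1]].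
Proof.
have [M Mf] := blin_bounded f; split; first by exists `|f 0|; exists 0 => //=; rewrite normr0.
exists `|M| => _ [x /= x1 <-]; rewrite (le_trans (Mf x))//.
by rewrite (le_trans (ler_norm _))// normrM normr_id ler_piMr.
Qed.

Lemma op_norm_ubound f x : `|x| <= 1 -> `|f x| <= op_norm f.
Proof. by move=> x1; apply: ub_le_sup; [case: (op_norm_has_sup f)|exists x]. Qed.

Lemma op_norm_lub f M : (forall x, `|x| <= 1 -> `|f x| <= M) -> op_norm f <= M.
Proof.
move=> fM; apply: ge_sup; first by case: (op_norm_has_sup f).
by move=> _ [x /= x1 <-]; exact: fM.
Qed.

Lemma op_norm_ge0 f : 0 <= op_norm f.
Proof. by rewrite (le_trans _ (@op_norm_ubound f 0 _)) ?normr0. Qed.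

Lemma le_op_norm f x : `|f x| <= op_norm f * `|x|.
Proof.
have [->|x0] := eqVneq x 0; first by rewrite linear0 !normr0 mulr0.
have nx0 : 0 < `|x| by rewrite normr_gt0.
rewrite -ler_pdivrMr//.
have -> : `|f x| / `|x| = `|f (`|x|^-1 *: x)|.
  by rewrite linearZ normrZ normfV normr_id mulrC.
by apply: op_norm_ubound; rewrite normrZ normfV normr_id mulVf// gt_eqF.
Qed.

Lemma op_normD f g : op_norm (f + g) <= op_norm f + op_norm g.
Proof.
apply: op_norm_lub => x x1.
by rewrite (le_trans (ler_normD _ _))// lerD// op_norm_ubound.
Qed.

Lemma op_normZ a f : op_norm (a *: f) = `|a| * op_norm f.
Proof.
have le b g : op_norm (b *: g) <= `|b| * op_norm g.
  apply: op_norm_lub => x x1.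
  by rewrite [X in `|X|]/(b *: g x) normrZ ler_wpM2l// op_norm_ubound.
have [->|a0] := eqVneq a 0.
  apply/eqP; rewrite normr0 mul0r eq_le op_norm_ge0 andbT.
  by rewrite (le_trans (le _ _))// normr0 mul0r.
apply/eqP; rewrite eq_le le /=.
rewrite -ler_pdivlMl ?normr_gt0// -normfV.
by rewrite (le_trans _ (le _ _))// scalerA mulVf// scale1r.
Qed.

Lemma op_norm0_eq0 f : op_norm f = 0 -> f = 0.
Proof.
move=> f0; apply: blinP => x; apply/eqP; rewrite -normr_le0.
by rewrite (le_trans (le_op_norm f x))// f0 mul0r.
Qed.

HB.instance Definition _ :=
  Lmodule_isNormed.Build R boundedLinear op_normD op_normZ op_norm0_eq0.

End bounded_linear.

Section bounded_linear_complete.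
Variables (R : realType) (E : normedModType R) (F : completeNormedModType R).

Lemma boundedLinear_complete (G : set_system (boundedLinear E F)) :
  ProperFilter G -> cauchy G -> cvg G.
Proof.
move=> PG cG.
have evc x : cvg ((fun f : boundedLinear E F => f x) @ G).
  apply: cauchy_cvg; apply/cauchy_ballP => e e0; rewrite near_simpl.
  have d0 : 0 < e / (`|x| + 1) by rewrite divr_gt0// ltr_wpDl.
  have /cauchy_ballP/(_ _ d0) := cG; rewrite near_simpl.
  apply: filterS => -[f g]; rewrite -!ball_normE /ball_/= => fg.
  rewrite (le_lt_trans (le_op_norm (f - g) x))//.
  rewrite (@le_lt_trans _ _ (`|f - g| * (`|x| + 1)))//.
    by apply: ler_wpM2l; rewrite ?lerDl// op_norm_ge0.
  by rewrite -ltr_pdivlMr// ltr_wpDl.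
pose l x := lim ((fun f : boundedLinear E F => f x) @ G).
have close (e : R) : 0 < e ->
    \forall f \near G, forall x, `|l x - (f : boundedLinear E F) x| <= e * `|x|.
  move=> e0; have /cauchy_ballP/(_ _ e0) := cG.
  move=> /nearP_dep; apply: filterS => f ff x.
  have cv : `|h x - f x| @[h --> G] --> `|l x - f x|.
    by apply: cvg_norm; apply: cvgB; [exact: evc|exact: cvg_cst].
  apply: (cvgr_to_le cv); move: ff; apply: filterS => g.
  rewrite -ball_normE /ball_/= => fg.
  rewrite distrC (le_trans (le_op_norm (f - g) x))//.
  by rewrite ler_wpM2r// ltW.
have ll : linear l.
  move=> a x y; rewrite /l.
  rewrite (_ : (fun f : boundedLinear E F => f (a *: x + y)) =
    (fun f : boundedLinear E F => a *: f x + f y)); last first.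
    by apply/funext => f; rewrite linearP.
  apply: cvg_lim => //; apply: cvgD; last exact: evc.
  by apply: cvgZr; exact: evc.
have lb : l \in @bounded_linear R E F.
  apply/bounded_linearP; split => //.
  have /filter_ex[f cf] := close _ ltr01.
  exists (`|f| + 1) => x; rewrite -[l x](subrK (f x)) addrC mulrDl.
  by rewrite (le_trans (ler_normD _ _))// lerD// le_op_norm.
apply/cvg_ex; exists (BoundedLinear lb); apply/cvgrPdist_le => e e0.
have := close _ e0; apply: filterS => f cf.
apply: op_norm_lub => x x1; rewrite (le_trans (cf x))//.
by rewrite ler_piMr// ltW.
Qed.

HB.instance Definition _ :=
  Uniform_isComplete.Build (boundedLinear E F) boundedLinear_complete.

End bounded_linear_complete.

(* The order is carried by this mixin and not by Order.Lattice because a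
   structure with both a norm and such an order must sit below numDomainType
   in the hierarchy and can no longer be declared. *)
HB.mixin Record isBanachLattice (R : realType) L & CompleteNormedModule R L := {
  lle : L -> L -> Prop ;
  ljoin : L -> L -> L ;
  lmeet : L -> L -> L ;
  llexx : forall x : L, lle x x ;
  lle_anti : forall x y : L, lle x y -> lle y x -> x = y ;
  lle_trans : forall y x z : L, lle x y -> lle y z -> lle x z ;
  ljoinP : forall x y z : L, lle (ljoin x y) z <-> lle x z /\ lle y z ;
  lmeetP : forall x y z : L, lle z (lmeet x y) <-> lle z x /\ lle z y ;
  lleD2r : forall x y z : L, lle x y -> lle (x + z) (y + z) ;
  lscale_ge0 : forall (a : R) (x : L), 0 <= a -> lle 0 x -> lle 0 (a *: x) ;
  lnorm_le : forall x y : L,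
    lle (ljoin x (- x)) (ljoin y (- y)) -> `|x| <= `|y|
}.

#[short(type="banachLatticeType")]
HB.structure Definition BanachLattice (R : realType) :=
  {L of CompleteNormedModule R L & isBanachLattice R L}.

Arguments lle_anti {R s} [x y].
Arguments lle_trans {R s} [y x z].
Arguments lleD2r {R s} [x y] z.
Arguments lscale_ge0 {R s} [a x].
Arguments lnorm_le {R s} [x y].

Notation "x <=L y" := (lle x y) (at level 70, no associativity) : ring_scope.

Definition labs (R : realType) (L : banachLatticeType R) (x : L) : L :=
  ljoin x (- x).

Section vector_lattice.
Variables (R : realType) (L : banachLatticeType R).
Implicit Types x y z u v w : L.

Definition lpos x : L := ljoin x 0.

Lemma ljoin_ubl x y : x <=L ljoin x y.
Proof. by have /ljoinP[] := llexx (ljoin x y). Qed.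

Lemma ljoin_ubr x y : y <=L ljoin x y.
Proof. by have /ljoinP[] := llexx (ljoin x y). Qed.

Lemma lmeet_lbl x y : lmeet x y <=L x.
Proof. by have /lmeetP[] := llexx (lmeet x y). Qed.

Lemma lmeet_lbr x y : lmeet x y <=L y.
Proof. by have /lmeetP[] := llexx (lmeet x y). Qed.

Lemma lle_subr0 x y : x <=L y <-> 0 <=L y - x.
Proof.
split=> [/(lleD2r (- x))|/(lleD2r x)]; first by rewrite subrr.
by rewrite add0r subrK.
Qed.

Lemma lleD x y z w : x <=L y -> z <=L w -> x + z <=L y + w.
Proof.
move=> xy zw; apply: (@lle_trans _ _ (y + z)); first exact: lleD2r.
by rewrite ![y + _]addrC; exact: lleD2r.
Qed.

Lemma lle_opp x y : x <=L y -> - y <=L - x.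
Proof. by move=> /lle_subr0 xy; apply/lle_subr0; rewrite opprK addrC. Qed.

Lemma lle_addr x y : 0 <=L y -> x <=L x + y.
Proof. by move=> y0; rewrite -{1}[x]addr0; apply: lleD => //; exact: llexx. Qed.

Lemma laddr_ge0 x y : 0 <=L x -> 0 <=L y -> 0 <=L x + y.
Proof. by move=> x0 y0; rewrite -[0 in X in X <=L _](addr0 0); exact: lleD. Qed.

Lemma ljoinDr x y z : ljoin x y + z = ljoin (x + z) (y + z).
Proof.
apply: lle_anti.
  rewrite -[X in _ <=L X](subrK z); apply: lleD2r; apply/ljoinP; split.
    by rewrite -[X in X <=L _](addrK z); apply: lleD2r; exact: ljoin_ubl.
  by rewrite -[X in X <=L _](addrK z); apply: lleD2r; exact: ljoin_ubr.
by apply/ljoinP; split; apply: lleD2r; [exact: ljoin_ubl|exact: ljoin_ubr].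
Qed.

Lemma lpos_ge0 x : 0 <=L lpos x. Proof. exact: ljoin_ubr. Qed.

Lemma ljoinC x y : ljoin x y = ljoin y x.
Proof.
by apply: lle_anti; apply/ljoinP; split;
  do ?[exact: ljoin_ubl|exact: ljoin_ubr].
Qed.

Lemma lposB x : lpos x - lpos (- x) = x.
Proof.
have -> : lpos x = lpos (- x) + x by rewrite /lpos ljoinDr addNr add0r ljoinC.
by rewrite addrAC subrr add0r.
Qed.

Lemma labs_ge x : x <=L labs x. Proof. exact: ljoin_ubl. Qed.

Lemma labs_geN x : - x <=L labs x. Proof. exact: ljoin_ubr. Qed.

Lemma labs_ge0 x : 0 <=L labs x.
Proof.
have : 0 <=L labs x + labs x.
  by rewrite -[0 in X in X <=L _](subrr x); apply: lleD;
    [exact: labs_ge|exact: labs_geN].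
move=> h; have -> : labs x = (2^-1 : R) *: (labs x + labs x).
  by rewrite -mulr2n -[X in _ *: X](@scaler_nat R) scalerA mulVf ?scale1r// pnatr_eq0.
by apply: lscale_ge0; rewrite ?invr_ge0.
Qed.

Lemma labs_id x : 0 <=L x -> labs x = x.
Proof.
move=> x0; apply: lle_anti; last exact: labs_ge.
apply/ljoinP; split; first exact: llexx.
by apply: (lle_trans _ x0); have := lle_opp x0; rewrite oppr0.
Qed.

Lemma norm_labs x : `|labs x| = `|x|.
Proof.
have a : labs (labs x) = labs x by apply: labs_id; exact: labs_ge0.
by apply/eqP; rewrite eq_le; apply/andP; split; apply: lnorm_le;
  rewrite -/(labs _) -/(labs _) a; exact: llexx.
Qed.

Lemma lnorm_mono x y : - y <=L x -> x <=L y -> `|x| <= `|y|.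
Proof.
move=> yx xy; apply: lnorm_le; apply: (@lle_trans _ _ y); last exact: ljoin_ubl.
by apply/ljoinP; split => //; have := lle_opp yx; rewrite opprK.
Qed.

Lemma norm_lpos x : `|lpos x| <= `|x|.
Proof.
rewrite -[leRHS]norm_labs; apply: lnorm_mono.
  apply: (@lle_trans _ _ 0); last exact: lpos_ge0.
  by have := lle_opp (labs_ge0 x); rewrite oppr0.
by apply/ljoinP; split; [exact: labs_ge|exact: labs_ge0].
Qed.

Lemma riesz_decomposition a v w : 0 <=L a -> 0 <=L v -> 0 <=L w ->
  a <=L v + w -> exists b c, [/\ a = b + c, 0 <=L b, b <=L v, 0 <=L c & c <=L w].
Proof.
move=> a0 v0 w0 avw; exists (lmeet a v), (a - lmeet a v); split.
- by rewrite addrC subrK.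
- exact/lmeetP.
- exact: lmeet_lbr.
- by apply/(lle_subr0 _ _).1/lmeet_lbl.
- have : a - w <=L lmeet a v.
    apply/lmeetP; split.
      by apply/lle_subr0; rewrite opprB addrC subrK.
    by apply/lle_subr0; rewrite opprB addrA; apply/(lle_subr0 _ _).1.
  move=> /lle_subr0 h; apply/lle_subr0; move: h.
  by rewrite opprB addrA opprB addrA [w + _]addrC.
Qed.

End vector_lattice.

Definition dual (R : realType) (E : normedModType R) : Type :=
  boundedLinear E R^o.

HB.instance Definition _ (R : realType) (E : normedModType R) :=
  CompleteNormedModule.copy (dual E) (boundedLinear E R^o).

Section pairing.
Variables (R : realType) (E : normedModType R).
Implicit Types (x y : dual E) (u v : E) (t : R).

Definition pairing x u : R := blin_fun x u.

Lemma pairingDr x u v : pairing x (u + v) = pairing x u + pairing x v.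
Proof. exact: linearD. Qed.
Lemma pairingNr x u : pairing x (- u) = - pairing x u.
Proof. exact: linearN. Qed.
Lemma pairingBr x u v : pairing x (u - v) = pairing x u - pairing x v.
Proof. exact: linearB. Qed.
Lemma pairingZr x t u : pairing x (t *: u) = t * pairing x u.
Proof. exact: linearZ. Qed.
Lemma pairing0r x : pairing x 0 = 0.
Proof. exact: linear0. Qed.
Lemma pairingDl x y u : pairing (x + y) u = pairing x u + pairing y u.
Proof. by []. Qed.
Lemma pairingNl x u : pairing (- x) u = - pairing x u.
Proof. by []. Qed.
Lemma pairingBl x y u : pairing (x - y) u = pairing x u - pairing y u.
Proof. by []. Qed.
Lemma pairingZl t x u : pairing (t *: x) u = t * pairing x u.
Proof. by []. Qed.
Lemma pairing0l u : pairing 0 u = 0.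
Proof. by []. Qed.

Lemma pairing_inj x y : (forall u, pairing x u = pairing y u) -> x = y.
Proof. by move=> xy; exact: blinP. Qed.

Lemma le_pairing x u : `|pairing x u| <= `|x| * `|u|.
Proof. exact: le_op_norm. Qed.

Lemma dual_norm_lub x (M : R) :
  (forall u, `|u| <= 1 -> `|pairing x u| <= M) -> `|x| <= M.
Proof. exact: op_norm_lub. Qed.

End pairing.

Section dual_of.
Variables (R : realType) (E : normedModType R) (f : E -> R).
Hypothesis fD : forall u v, f (u + v) = f u + f v.
Hypothesis fZ : forall (t : R) u, f (t *: u) = t * f u.
Hypothesis fB : exists M : R, forall u, `|f u| <= M * `|u|.

Fact dual_of_subproof : (f : E -> R^o) \in @bounded_linear R E R^o.
Proof. by apply/bounded_linearP; split => // t u v; rewrite fD fZ. Qed.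

Definition dual_of : dual E := BoundedLinear dual_of_subproof.

Lemma dual_ofE u : pairing dual_of u = f u. Proof. by []. Qed.

End dual_of.

Section dual_lattice.
Variables (R : realType) (L : banachLatticeType R).
Implicit Types (x y z : dual L) (u v w a b : L).

Definition dual_le x y : Prop :=
  forall u, 0 <=L u -> pairing x u <= pairing y u.

(* Riesz-Kantorovich formula for the value at v >= 0 of the positive part of
   z. *)
Let P z v : R := sup [set pairing z a | a in [set a | 0 <=L a /\ a <=L v]].

Let lnorm_le0 a v : 0 <=L a -> a <=L v -> `|a| <= `|v|.
Proof.
move=> a0 av; apply: lnorm_mono => //; apply: (lle_trans _ a0).
by have := lle_opp (lle_trans a0 av); rewrite oppr0.
Qed.

Let P_has_sup z v : 0 <=L v ->
  has_sup [set pairing z a | a in [set a | 0 <=L a /\ a <=L v]].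
Proof.
move=> v0; split.
  by exists (pairing z 0); exists 0 => //; split => //; exact: llexx.
exists (`|z| * `|v|) => _ [a [a0 av] <-].
rewrite (le_trans (ler_norm _))// (le_trans (le_pairing z a))//.
by apply: ler_wpM2l => //; exact: lnorm_le0.
Qed.

Let P_ub z v a : 0 <=L a -> a <=L v -> pairing z a <= P z v.
Proof.
move=> a0 av; apply: ub_le_sup; last by exists a.
by have [] := P_has_sup z (lle_trans a0 av).
Qed.

Let P_lub z v (M : R) : 0 <=L v ->
  (forall a, 0 <=L a -> a <=L v -> pairing z a <= M) -> P z v <= M.
Proof.
move=> v0 zM; apply: ge_sup; first by have [] := P_has_sup z v0.
by move=> _ [a [a0 av] <-]; exact: zM.
Qed.

Let P_ge0 z v : 0 <=L v -> 0 <= P z v.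
Proof. by move=> v0; rewrite -(pairing0r z); apply: P_ub => //; exact: llexx. Qed.

Let P0 z : P z 0 = 0.
Proof.
apply/eqP; rewrite eq_le P_ge0 ?andbT; last exact: llexx.
apply: P_lub; first exact: llexx.
by move=> a a0 /lle_anti /(_ a0) ->; rewrite pairing0r.
Qed.

Let PD z v w : 0 <=L v -> 0 <=L w -> P z (v + w) = P z v + P z w.
Proof.
move=> v0 w0; have vw0 := laddr_ge0 v0 w0.
apply/eqP; rewrite eq_le; apply/andP; split.
  apply: P_lub => // a a0 /(riesz_decomposition a0 v0 w0)[b [c [-> *]]].
  by rewrite pairingDr lerD// P_ub.
rewrite -lerBrDr; apply: P_lub => // a a0 av.
rewrite lerBrDl -lerBrDr; apply: P_lub => // b b0 bw.
rewrite lerBrDl -pairingDr; apply: P_ub; first exact: laddr_ge0.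
exact: lleD.
Qed.

Let PZ z (t : R) v : 0 <= t -> 0 <=L v -> P z (t *: v) = t * P z v.
Proof.
rewrite le_eqVlt => /predU1P[<- _|t0 v0]; first by rewrite scale0r P0 mul0r.
have le (s : R) w : 0 < s -> 0 <=L w -> P z (s *: w) <= s * P z w.
  move=> s0 w0; apply: P_lub; first by apply: lscale_ge0 => //; exact: ltW.
  move=> a a0 aw; rewrite -ler_pdivrMl//.
  have si0 : 0 <= s^-1 by rewrite invr_ge0 ltW.
  rewrite -pairingZr; apply: P_ub; first exact: lscale_ge0.
  apply: (lle_subr0 _ _).2.
  have -> : w - s^-1 *: a = s^-1 *: (s *: w - a).
    by rewrite scalerBr scalerA mulVf ?scale1r// gt_eqF.
  by apply: lscale_ge0 => //; exact: (lle_subr0 _ _).1.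
apply/eqP; rewrite eq_le le//= -ler_pdivlMl//.
have {1}-> : v = t^-1 *: (t *: v) by rewrite scalerA mulVf ?scale1r// gt_eqF.
by apply: le; [rewrite invr_gt0|apply: lscale_ge0 => //; exact: ltW].
Qed.

Let Q z u : R := P z (lpos u) - P z (lpos (- u)).

Let QE z v w : 0 <=L v -> 0 <=L w -> Q z (v - w) = P z v - P z w.
Proof.
move=> v0 w0; set u := v - w.
have p0 := lpos_ge0 u; have n0 := lpos_ge0 (- u).
have e : lpos u + w = v + lpos (- u).
  have -> : v = u + w by rewrite subrK.
  by rewrite -{2}(lposB u) addrAC subrK.
by apply/eqP; rewrite /Q subr_eq addrAC eq_sym subr_eq -!PD// e.
Qed.

Let QD z u w : Q z (u + w) = Q z u + Q z w.
Proof.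
rewrite -{1}(lposB u) -{1}(lposB w) addrACA -opprD.
have p0 := lpos_ge0; have d0 u1 u2 := laddr_ge0 (p0 _ _ u1) (p0 _ _ u2).
by rewrite QE ?PD// opprD addrACA.
Qed.

Let QZ z (t : R) u : Q z (t *: u) = t * Q z u.
Proof.
have QN w : Q z (- w) = - Q z w by rewrite /Q opprK opprB.
have p0 := lpos_ge0.
have pos (s : R) w : 0 <= s -> Q z (s *: w) = s * Q z w.
  move=> s0; rewrite -{1}(lposB w) scalerBr QE; do ?exact: lscale_ge0.
  by rewrite !PZ// -mulrBr.
have [t0|/ltW t0] := leP 0 t; first exact: pos.
by rewrite -[t]opprK scaleNr QN pos ?oppr_ge0// !mulNr.
Qed.

Let QM z : exists M : R, forall u, `|Q z u| <= M * `|u|.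
Proof.
exists (`|z| + `|z|) => u.
have b w : `|w| <= `|u| -> 0 <=L w -> `|P z w| <= `|z| * `|u|.
  move=> wu w0; rewrite ger0_norm ?P_ge0//; apply: P_lub => // a a0 aw.
  rewrite (le_trans (ler_norm _))// (le_trans (le_pairing z a))//.
  by apply: ler_wpM2l => //; apply: le_trans wu; exact: lnorm_le0.
rewrite (le_trans (ler_normB _ _))// mulrDl lerD//; apply: b.
- exact: norm_lpos.
- exact: lpos_ge0.
- by rewrite -[leRHS]normrN; exact: norm_lpos.
- exact: lpos_ge0.
Qed.

Let dpos z : dual L := dual_of (QD z) (QZ z) (QM z).

Let dposE z v : 0 <=L v -> pairing (dpos z) v = P z v.
Proof.
by move=> v0; rewrite dual_ofE -[v in LHS]subr0 QE ?P0 ?subr0//; exact: llexx.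
Qed.

Definition dual_join x y : dual L := y + dpos (x - y).
Definition dual_meet x y : dual L := - dual_join (- x) (- y).

Let dual_joinE x y v : 0 <=L v ->
  pairing (dual_join x y) v = pairing y v + P (x - y) v.
Proof. by move=> v0; rewrite pairingDl dposE. Qed.

Lemma dual_lexx x : dual_le x x. Proof. by []. Qed.

Lemma dual_le_anti x y : dual_le x y -> dual_le y x -> x = y.
Proof.
move=> xy yx; have e v : 0 <=L v -> pairing x v = pairing y v.
  by move=> v0; apply/eqP; rewrite eq_le xy//= yx.
apply: pairing_inj => u; rewrite -(lposB u) !pairingBr.
by congr (_ - _); apply: e; exact: lpos_ge0.
Qed.

Lemma dual_le_trans y x z : dual_le x y -> dual_le y z -> dual_le x z.
Proof. by move=> xy yz u u0; exact: le_trans (xy u u0) (yz u u0). Qed.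

Lemma dual_joinP x y z :
  dual_le (dual_join x y) z <-> dual_le x z /\ dual_le y z.
Proof.
split=> [h|[xz yz] v v0].
  split=> v v0; apply: le_trans (h v v0); rewrite dual_joinE//.
    by rewrite -lerBlDl -pairingBl; apply: P_ub => //; exact: llexx.
  by rewrite lerDl P_ge0.
rewrite dual_joinE// -lerBrDl; apply: P_lub => // a a0 av.
have := yz _ ((lle_subr0 _ _).1 av); have := xz a a0.
by rewrite !pairingBr pairingBl; lra.
Qed.

Lemma dual_le_opp x y : dual_le x y -> dual_le (- y) (- x).
Proof. by move=> xy v v0; rewrite !pairingNl lerN2; exact: xy. Qed.

Lemma dual_meetP x y z :
  dual_le z (dual_meet x y) <-> dual_le z x /\ dual_le z y.
Proof.
split=> [/dual_le_opp|[zx zy]].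
  rewrite /dual_meet opprK => /dual_joinP[/dual_le_opp + /dual_le_opp].
  by rewrite !opprK.
rewrite -[z]opprK; apply: dual_le_opp; apply/dual_joinP.
by split; exact: dual_le_opp.
Qed.

Lemma dual_leD2r x y z : dual_le x y -> dual_le (x + z) (y + z).
Proof. by move=> xy v v0; rewrite !pairingDl lerD2r; exact: xy. Qed.

Lemma dual_scale_ge0 (t : R) x : 0 <= t -> dual_le 0 x -> dual_le 0 (t *: x).
Proof.
by move=> t0 x0 v v0; rewrite pairingZl pairing0l mulr_ge0//; exact: x0.
Qed.

Lemma dual_norm_le x y :
  dual_le (dual_join x (- x)) (dual_join y (- y)) -> `|x| <= `|y|.
Proof.
move=> xy; apply: dual_norm_lub => u u1.
have s0 := labs_ge0 u; set s := labs u in s0 *.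
have xu : `|pairing x u| <= pairing (dual_join x (- x)) s.
  have [jx jN] := (dual_joinP x (- x) _).1 (dual_lexx _).
  have sp : 0 <=L s + u.
    by have := (lle_subr0 _ _).1 (labs_geN u); rewrite opprK.
  have sm : 0 <=L s - u by exact: (lle_subr0 _ _).1 (labs_ge u).
  have := lerD (jx _ sp) (jN _ sm); have := lerD (jN _ sp) (jx _ sm).
  rewrite !pairingNl !(pairingDr, pairingNr) => h1 h2.
  by rewrite ler_norml; apply/andP; split; lra.
apply: (le_trans xu); apply: le_trans (xy _ s0) _.
rewrite dual_joinE// -lerBrDl; apply: P_lub => // a a0 au.
have : pairing y (a + a - s) <= `|y|.
  rewrite (le_trans (ler_norm _))// (le_trans (le_pairing y _))//.
  rewrite ler_piMr// (le_trans _ u1)// -(norm_labs u) -/s; apply: lnorm_mono.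
    by apply: (lle_subr0 _ _).2; rewrite opprK subrK; exact: laddr_ge0.
  apply: (lle_subr0 _ _).2; rewrite opprB addrA opprD addrACA.
  by apply: laddr_ge0; exact: (lle_subr0 _ _).1.
by rewrite pairingBl !pairingNl pairingBr pairingDr; lra.
Qed.

HB.instance Definition _ := @isBanachLattice.Build R (dual L)
  dual_le dual_join dual_meet dual_lexx dual_le_anti dual_le_trans
  dual_joinP dual_meetP dual_leD2r dual_scale_ge0 dual_norm_le.

End dual_lattice.

Definition weak_star (R : realType) (E : normedModType R) : Type :=
  initial_topology (fun x : dual E => (pairing x : {ptws E -> R})).

HB.instance Definition _ (R : realType) (E : normedModType R) :=
  Topological.copy (weak_star E)
    (initial_topology (fun x : dual E => (pairing x : {ptws E -> R}))).

Definition sequentially_compact (T : topologicalType) (K : set T) : Prop :=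
  forall x : nat -> T, (forall n, K (x n)) ->
    exists phi : nat -> nat, exists2 l : T,
      K l & {homo phi : m n / (m < n)%N} /\ (fun n => x (phi n)) @ \oo --> l.

Section operators.
Variables (R : realType).

Section blin_of.
Variables (E F : normedModType R) (f : E -> F).
Hypothesis fD : forall u v, f (u + v) = f u + f v.
Hypothesis fZ : forall (t : R) u, f (t *: u) = t *: f u.
Hypothesis fB : exists M : R, forall u, `|f u| <= M * `|u|.

Fact blin_of_subproof : f \in @bounded_linear R E F.
Proof. by apply/bounded_linearP; split => // t u v; rewrite fD fZ. Qed.

Definition blin_of : boundedLinear E F := BoundedLinear blin_of_subproof.

End blin_of.

Section blin_id.
Variable E : normedModType R.

Fact blin_id_bounded : exists M : R, forall u : E, `|u| <= M * `|u|.
Proof. by exists 1 => u; rewrite mul1r. Qed.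

Definition blin_id : boundedLinear E E :=
  blin_of (fun _ _ => erefl) (fun _ _ => erefl) blin_id_bounded.

End blin_id.

Section adjoint.
Variables (E F : normedModType R) (T : boundedLinear E F) (p : dual F).

Let f u : R := pairing p (T u).
Fact adjoint_D u v : f (u + v) = f u + f v.
Proof. by rewrite /f linearD pairingDr. Qed.
Fact adjoint_Z (t : R) u : f (t *: u) = t * f u.
Proof. by rewrite /f linearZ pairingZr. Qed.
Fact adjoint_bounded : exists M : R, forall u, `|f u| <= M * `|u|.
Proof.
exists (`|p| * `|T|) => u; rewrite (le_trans (le_pairing _ _))// -mulrA.
by apply: ler_wpM2l => //; exact: le_op_norm.
Qed.

Definition adjoint : dual E := dual_of adjoint_D adjoint_Z adjoint_bounded.

End adjoint.

Section dual_pair.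
Variables (F : normedModType R) (mu : dual F * dual F).

Let f (y : F * F) : R := pairing mu.1 y.1 + pairing mu.2 y.2.
Fact dual_pair_D y z : f (y + z) = f y + f z.
Proof. by rewrite /f !pairingDr addrACA. Qed.
Fact dual_pair_Z (t : R) y : f (t *: y) = t * f y.
Proof. by rewrite /f !pairingZr mulrDr. Qed.
Fact dual_pair_bounded : exists M : R, forall y, `|f y| <= M * `|y|.
Proof.
exists (`|mu.1| + `|mu.2|) => y; rewrite (le_trans (ler_normD _ _))// mulrDl.
apply: lerD; apply: (le_trans (le_pairing _ _)); apply: ler_wpM2l => //.
  by rewrite prod_normE le_max lexx.
by rewrite prod_normE le_max lexx orbT.
Qed.

Definition dual_pair : dual (F * F)%type :=
  dual_of dual_pair_D dual_pair_Z dual_pair_bounded.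

End dual_pair.

Section constraint_op.
Variables (E F : normedModType R) (S T : boundedLinear E F).

Let f (u : E) : F * F := (S u, - T u).
Fact constraint_op_D u v : f (u + v) = f u + f v.
Proof. by congr pair; rewrite linearD// opprD. Qed.
Fact constraint_op_Z (t : R) u : f (t *: u) = t *: f u.
Proof. by congr pair; rewrite linearZ//= scalerN. Qed.
Fact constraint_op_bounded : exists M : R, forall u, `|f u| <= M * `|u|.
Proof.
exists (`|S| + `|T|) => u; rewrite prod_normE/= normrN mulrDl ge_max.
have S0 : 0 <= `|S| * `|u| by rewrite mulr_ge0.
have T0 : 0 <= `|T| * `|u| by rewrite mulr_ge0.
rewrite (le_trans (le_op_norm S u)) ?lerDl//=.
by rewrite (le_trans (le_op_norm T u)) ?lerDr.
Qed.

Definition constraint_op : boundedLinear E (F * F)%type :=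
  blin_of constraint_op_D constraint_op_Z constraint_op_bounded.

End constraint_op.
End operators.

Section convex_analysis.
Variables (R : realType) (E : normedModType R).
Implicit Types (F : E -> \bar R) (p q : dual E) (u w : E).
Local Open Scope ereal_scope.

Definition domain F : set E := [set u | F u < +oo].

Definition proper_function F : Prop := (forall u, -oo < F u) /\ domain F !=set0.

Definition convex_ereal F : Prop := forall u w (t : R), (0 <= t <= 1)%R ->
  F (t *: u + (1 - t) *: w)%R <= t%:E * F u + (1 - t)%:E * F w.

(* If F is proper, this is empty at every w outside domain F. *)
Definition subdifferential F w : set (dual E) :=
  [set p | forall u, F w + (pairing p (u - w)%R)%:E <= F u].

Definition conjugate F p : \bar R :=
  ereal_sup [set (pairing p u)%:E - F u | u in [set: E]].

Definition bregman F p u w : \bar R := F u - F w - (pairing p (u - w)%R)%:E.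

(* For q in the subdifferential at u and p in the subdifferential at w. *)
Definition symm_bregman q p u w : R := pairing (q - p)%R (u - w)%R.

End convex_analysis.

Section positive_operators.
Variables (R : realType) (L M : banachLatticeType R).
Implicit Types S T : L -> M.

Definition op_le S T : Prop := forall u, 0 <=L u -> S u <=L T u.

(* A positive linear operator between Banach lattices is bounded. *)
Definition regular_op T : Prop :=
  exists P Q : {linear L -> M},
    [/\ op_le (fun=> 0) P, op_le (fun=> 0) Q & forall u, T u = P u - Q u].

Definition AM_space : Prop := forall x y : M, 0 <=L x -> 0 <=L y ->
  `|ljoin x y| = Num.max `|x| `|y|.

Definition order_unit (e : M) : Prop :=
  [/\ 0 <=L e, `|e| = 1 & forall x : M, `|x| <= 1 -> labs x <=L e].

End positive_operators.
Arguments AM_space {R} M.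

Definition weak_star_continuous (R : realType) (E F : normedModType R)
    (T : dual E -> dual F) : Prop :=
  continuous (T : weak_star E -> weak_star F).

Section variational_problem.
Variables (R : realType) (U V : banachLatticeType R).
Variables (J : dual U -> \bar R) (H : dual V -> dual V -> \bar R).
Variables (Al Au : boundedLinear (dual U) (dual V)).
Variables (alpha : R) (f : dual V).
Implicit Types (u : dual U) (v e : dual V) (mu : dual (dual V) * dual (dual V)).
Local Open Scope ereal_scope.

Definition feasible u v : Prop := Al u <=L v /\ v <=L Au u.

Definition primal_objective u v : \bar R := alpha^-1%:E * H v f + J u.

Definition primal_solution u v : Prop :=
  feasible u v /\ forall u' v', feasible u' v' ->
    primal_objective u v <= primal_objective u' v'.

(* E v = (v, - v) and, for B u = (S u, - T u), the adjoints on pairs. *)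
Definition Estar mu : dual (dual V) :=
  adjoint (constraint_op (blin_id (dual V)) (blin_id (dual V))) (dual_pair mu).

Definition Bstar (S T : boundedLinear (dual U) (dual V)) mu : dual (dual U) :=
  adjoint (constraint_op S T) (dual_pair mu).

Definition dual_objective mu : \bar R :=
  - (alpha^-1%:E * conjugate (H ^~ f) (alpha *: Estar mu)%R)
  - conjugate J (- Bstar Al Au mu)%R.

Definition nonneg_pair mu : Prop := (0 <=L mu.1)%R /\ (0 <=L mu.2)%R.

Definition dual_solution mu : Prop :=
  nonneg_pair mu /\ forall nu, nonneg_pair nu ->
    dual_objective nu <= dual_objective mu.

Definition strictly_feasible e : Prop :=
  exists u0 v0 (eps : R), [/\ domain J u0, domain (H ^~ f) v0, (0 < eps)%R,
    (Al u0 + eps *: e <=L v0)%R & (v0 <=L Au u0 - eps *: e)%R].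

End variational_problem.

Section rates.
Variable R : realType.
Implicit Types (lambda K : R) (a b alpha delta eta g : nat -> R).

Definition ereal_bigO (D : nat -> \bar R) g : Prop :=
  (\forall n \near \oo, D n \is a fin_num) /\
  ((fun n => fine (D n)) : nat -> R^o) =O_\oo (g : nat -> R^o).

(* Division by zero is zero, so the lower bound forces every b n to be
   nonzero. *)
Definition same_order a b : Prop :=
  exists c C : R, [/\ 0 < c, 0 < C & forall n, c <= a n / b n <= C].

Definition general_rate lambda alpha delta eta (D : nat -> \bar R) : Prop :=
  (1 < lambda -> ereal_bigO D (fun n =>
     delta n / alpha n + alpha n `^ (lambda - 1)^-1 + delta n `^ lambda^-1
     + eta n)) /\
  (lambda = 1 -> ereal_bigO D (fun n =>
     delta n / alpha n + delta n + eta n)).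

(* K stands for the norm of Estar mu. Its inverse is taken in the extended
   reals, where the inverse of 0 is +oo: there is no restriction on the
   constant when K = 0. *)
Definition parameter_choice lambda K alpha delta : Prop :=
  (1 < lambda ->
     same_order alpha (fun n => delta n `^ ((lambda - 1) / lambda))) /\
  (lambda = 1 ->
     exists2 c : R, (forall n, alpha n = c) & (c%:E <= K%:E^-1)%E).

Definition optimal_rate lambda delta eta (D : nat -> \bar R) : Prop :=
  ereal_bigO D (fun n => delta n `^ lambda^-1 + eta n).

End rates.

(* Main.v *)
Require Import Defs.
From HB Require Import structures.
From mathcomp Require Import all_boot all_order all_algebra.
From mathcomp Require Import ring lra.
From mathcomp Require Import all_classical all_reals all_analysis.

Set Implicit Arguments.
Unset Strict Implicit.
Unset Printing Implicit Defensive.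

Import Order.TTheory GRing.Theory Num.Theory.
Import numFieldNormedType.Exports.

Local Open Scope classical_set_scope.
Local Open Scope ring_scope.

(** A single quantity dominates both Bregman distances.  Write h_n for
    H(v_n | f_n), p for the source subgradient - B^* mu and call
      G_n = delta_n / alpha_n - h_n / alpha_n - <p, u_n - udag>
    the gap.  As (udag, fbar) is feasible, minimality of (u_n, v_n) gives
    h_n / alpha_n + J(u_n) <= delta_n / alpha_n + J(udag), hence
    D^p(u_n, udag) <= G_n.  For the symmetric distance one adds
    D^{p_n}(udag, u_n).  A dual optimal mu_n satisfies complementary slackness
    and E^* mu_n is a subgradient of H(. | f_n) / alpha_n at v_n, so that
    J(u_n) cancels in the sum of the two distances and G_n remains the bound.

    To estimate G_n, write - <p, u_n - udag> = <E^* mu, A u_n - fbar> and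
    insert v_n and f_n between A u_n and fbar.
    - The constraint A^l_n u_n <= v_n <= A^u_n u_n and mu >= 0 leave an operator
      error of order eta_n |u_n| ([source_pairing_le]).  The vectors u_n need
      not be bounded when delta_n / alpha_n is not, but sublevel sets of J are
      bounded by the uniform boundedness principle, and then convexity forces J
      to grow at least linearly: |u_n| = O(1 + delta_n / alpha_n)
      ([convex_linear_growth]).
    - The term |fbar - f_n| is O(delta_n^(1/lambda)) by coercivity.
    - The term K |v_n - f_n| with K = |E^* mu| is absorbed by - h_n / alpha_n:
      Young's inequality leaves O(alpha_n^(1/(lambda-1))) if lambda > 1
      ([young_penalty]), and nothing is left if lambda = 1 and K alpha_n <= 1.

    Dual solutions exist because the strict feasibility condition is a Slater
    condition: an order unit dominates the unit ball, so the strictly feasible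
    point satisfies all slightly perturbed constraints and the value function of
    the perturbed problem is bounded above near 0.  A Lagrange
    multiplier is then the opposite of a linear functional below the directional
    derivative of the value function at 0 ([slater_multiplier]), and such a
    functional comes from the Hahn-Banach theorem for sublinear functions. *)

(** * The Hahn-Banach theorem for sublinear functions *)

Section hahn_banach.
Context {R : realType} {E : lmodType R}.
Implicit Types (p q : E -> R) (x y : E).

(** Subhomogeneity under positive scalars is enough: applied to t and to its
    inverse it gives homogeneity, and it makes p 0 nonpositive. *)
Definition sublinear p : Prop :=
  [/\ forall x y, p (x + y) <= p x + p y,
      forall (t : R) x, 0 < t -> p (t *: x) <= t * p x & 0 <= p 0].

(** The common source of all the sublinear functions below: minimal elements of
    chains, the perturbations in the proof that minimal sublinear functions are
    linear, and the directional derivative of a convex value function.  The sets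
    Q x are bounded below because the sum of an element of Q x and one of
    Q (- x) dominates an element of Q 0, which is nonnegative. *)
Lemma inf_sublinear (Q : E -> set R) :
  (forall x, Q x !=set0) ->
  (forall x y a b, Q x a -> Q y b -> exists2 c, Q (x + y) c & c <= a + b) ->
  (forall (t : R) x a, 0 < t -> Q x a ->
     exists2 c, Q (t *: x) c & c <= t * a) ->
  (forall a, Q 0 a -> 0 <= a) ->
  sublinear (fun x => inf (Q x)) /\ forall x a, Q x a -> inf (Q x) <= a.
Proof.
move=> Qn QD QZ Q0.
have hi x : has_inf (Q x).
  split; first exact: Qn.
  have [b Qb] := Qn (- x); exists (- b) => a Qa.
  have [c] := QD _ _ _ _ Qa Qb; rewrite subrr => /Q0 c0 cab.
  by rewrite -subr_ge0 opprK (le_trans c0).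
have lb x a : Q x a -> inf (Q x) <= a.
  by move=> Qa; apply: ge_inf => //; case: (hi x).
split => //; split=> [x y|t x t0|].
- rewrite -lerBlDr; apply: lb_le_inf; first exact: Qn.
  move=> a Qa; rewrite lerBlDr -lerBlDl; apply: lb_le_inf; first exact: Qn.
  move=> b Qb; rewrite lerBlDl; have [c Qc cab] := QD _ _ _ _ Qa Qb.
  exact: le_trans (lb _ _ Qc) cab.
- rewrite -ler_pdivrMl//; apply: lb_le_inf; first exact: Qn.
  move=> a Qa; rewrite ler_pdivrMl//; have [c Qc cta] := QZ _ _ _ t0 Qa.
  exact: le_trans (lb _ _ Qc) cta.
- by apply: lb_le_inf; [exact: Qn|exact: Q0].
Qed.

Lemma sublinear0 p : sublinear p -> p 0 = 0.
Proof.
move=> [_ pZ p0]; apply/eqP; rewrite eq_le p0 andbT.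
by have := pZ 2^-1 0; rewrite scaler0 invr_gt0 ltr0n => /(_ isT); lra.
Qed.

Lemma sublinearZ p (t : R) x : sublinear p -> 0 <= t -> p (t *: x) = t * p x.
Proof.
move=> sp; rewrite le_eqVlt => /predU1P[<-|t0].
  by rewrite scale0r mul0r sublinear0.
have [_ pZ _] := sp; apply/eqP; rewrite eq_le pZ//= -ler_pdivlMl//.
have := pZ t^-1 (t *: x); rewrite scalerA mulVf ?gt_eqF// scale1r.
by rewrite invr_gt0; exact.
Qed.

(** For fixed y, the infimum over t >= 0 of p (x + t y) - t p y is a sublinear
    function of x below p.  By minimality it is p, and t = 1 then yields the
    superadditivity p x + p y <= p (x + y). *)
Lemma minimal_sublinear_linear p : sublinear p ->
  (forall p', sublinear p' -> (forall x, p' x <= p x) ->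
     forall x, p x <= p' x) ->
  (forall x y, p (x + y) = p x + p y) /\
  (forall (t : R) x, p (t *: x) = t * p x).
Proof.
move=> sp pmin; have [pD pZ p0] := sp.
have add x y : p (x + y) = p x + p y.
  apply/eqP; rewrite eq_le pD/=.
  pose Q z := [set p (z + t *: y) - t * p y | t in [set t : R | 0 <= t]].
  have [|||_ [t /= t0 <-]|sQ leQ] := @inf_sublinear Q.
  - by move=> z; exists (p (z + 0 *: y) - 0 * p y), 0 => /=.
  - move=> z w _ _ [s /= s0 <-] [t /= t0 <-].
    exists (p (z + w + (s + t) *: y) - (s + t) * p y).
      by exists (s + t) => //=; exact: addr_ge0.
    have := pD (z + s *: y) (w + t *: y).
    by rewrite addrACA -scalerDl; lra.
  - move=> t z _ t0 [s /= s0 <-].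
    exists (p (t *: z + (t * s) *: y) - (t * s) * p y).
      by exists (t * s) => //=; rewrite mulr_ge0// ltW.
    have := pZ t (z + s *: y) t0.
    by rewrite scalerDr scalerA mulrBr mulrA; lra.
  - by rewrite add0r sublinearZ// subrr.
  have Qle z : inf (Q z) <= p z.
    by apply: leQ; exists 0 => //=; rewrite scale0r addr0 mul0r subr0.
  have := pmin _ sQ Qle x.
  have : inf (Q x) <= p (x + y) - p y.
    by apply: leQ; exists 1 => //=; rewrite ?scale1r ?mul1r.
  lra.
split=> // t x.
have [t0|t0] := leP 0 t; first exact: sublinearZ.
have := add (t *: x) (- t *: x); rewrite -scalerDl subrr scale0r.
by rewrite sublinear0// [X in _ + X]sublinearZ ?oppr_ge0 ?ltW//; lra.
Qed.

(** By Zorn's lemma: the pointwise infimum of a chain of sublinear functions is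
    sublinear. *)
Lemma exists_minimal_sublinear q : sublinear q ->
  exists p, [/\ sublinear p, forall x, p x <= q x &
    forall p', sublinear p' -> (forall x, p' x <= p x) ->
      forall x, p x <= p' x].
Proof.
move=> sq; pose below p := sublinear p /\ forall x, p x <= q x.
pose T := {p | below p}.
pose ge (s t : T) := `[< forall x, sval t x <= sval s x >].
pose q0 : T := exist below q (conj sq (fun x => lexx _)).
have [t|r s t /asboolP rs /asboolP st|A totA|] := @ZL_preorder T q0 ge.
- by apply/asboolP.
- by apply/asboolP => x; exact: le_trans (st x) (rs x).
- have [A0|/set0P/negP/negPn/eqP A0] := pselect (A !=set0); last first.
    by exists q0 => s; rewrite A0.
  pose Q x := [set sval p x | p in A].
  have [||||sQ leQ] := @inf_sublinear Q.
  + by move=> x; have [p Ap] := A0; exists (sval p x), p.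
  + move=> x y _ _ [p Ap <-] [p' Ap' <-].
    have [/asboolP pp|/asboolP pp] := totA _ _ Ap Ap'.
      exists (sval p' (x + y)); first by exists p'.
      have [[pD _ _] _] := svalP p'; apply: (le_trans (pD _ _)).
      by rewrite lerD2r.
    exists (sval p (x + y)); first by exists p.
    have [[pD _ _] _] := svalP p; apply: (le_trans (pD _ _)).
    by rewrite lerD2l.
  + move=> t x _ t0 [p Ap <-]; exists (sval p (t *: x)); first by exists p.
    by have [[_ pZ _] _] := svalP p; exact: pZ.
  + by move=> _ [p Ap <-]; have [[]] := svalP p.
  have Qq x : inf (Q x) <= q x.
    have [p Ap] := A0; apply: (@le_trans _ _ (sval p x)).
      by apply: leQ; exists p.
    by have [_] := svalP p; exact.
  exists (exist below (fun x => inf (Q x)) (conj sQ Qq)) => s As.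
  apply/asboolP => x /=.
  by apply: leQ; exists s.
move=> [p [sp pq]] pmax; exists p; split => // p' sp' p'p.
have p'q x : p' x <= q x by exact: le_trans (p'p x) (pq x).
pose s : T := exist below p' (conj sp' p'q).
by have /asboolP := pmax s ltac:(exact/asboolP).
Qed.

Theorem hahn_banach_sublinear q : sublinear q ->
  exists g : E -> R, [/\ forall x y, g (x + y) = g x + g y,
    forall (t : R) x, g (t *: x) = t * g x & forall x, g x <= q x].
Proof.
move=> /exists_minimal_sublinear[p [sp pq pmin]]; exists p.
by have [pD pZ] := minimal_sublinear_linear sp pmin.
Qed.

End hahn_banach.

(** * Lagrange multipliers under a Slater condition *)

Section slater.
Context {R : realType} {X Z : normedModType R}.
Variables (phi : X -> \bar R) (G : {linear X -> Z}) (P : set Z) (m : R).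
Hypothesis phi_convex : convex_ereal phi.
Hypothesis PD : forall z w, P z -> P w -> P (z + w).
Hypothesis PZ : forall (t : R) z, 0 <= t -> P z -> P (t *: z).
Hypothesis m_le : forall x, P (- G x) -> (m%:E <= phi x)%E.

Lemma convex_ereal_le (x y : X) (a b t : R) : 0 <= t <= 1 ->
  (phi x <= a%:E)%E -> (phi y <= b%:E)%E ->
  (phi (t *: x + (1 - t) *: y)%R <= (t * a + (1 - t) * b)%:E)%E.
Proof.
move=> t01 xa yb; apply: (le_trans (phi_convex _ _ t01)).
have /andP[t0 t1] := t01.
rewrite [leRHS]EFinD [(t * a)%:E]EFinM [((1 - t) * b)%:E]EFinM.
by rewrite leeD// lee_wpmul2l// lee_fin ?subr_ge0.
Qed.

(* If m is the value at 0 of the function w |-> inf {phi x | P (w - G x)}, the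
   infimum of Q z is the directional derivative of that function at 0 in the
   direction z; phi x is replaced by its real upper bounds r, so that only
   finite values occur. *)
Let Q z : set R := [set s | exists t r x,
  [/\ 0 < t, (phi x <= r%:E)%E, P (t *: z - G x) & s = (r - m) / t]].

Let Qadd z w a b : Q z a -> Q w b -> exists2 c, Q (z + w) c & c <= a + b.
Proof.
move=> [t1 [r1 [x1 [t10 xr1 P1 ->]]]] [t2 [r2 [x2 [t20 xr2 P2 ->]]]].
(* The convex combination of x1 and x2 whose weights equalise the step sizes
   th t1 and (1 - th) t2. *)
have T0 : 0 < t1 + t2 by exact: addr_gt0.
pose th := t2 / (t1 + t2).
have th01 : 0 <= th <= 1.
  by rewrite divr_ge0 ?(ltW T0) ?(ltW t20)//= ler_pdivrMr// mul1r lerDr ltW.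
have thE : 1 - th = t1 / (t1 + t2) by rewrite /th; field; exact: lt0r_neq0.
have t0 : 0 < th * t1 by rewrite mulr_gt0// divr_gt0.
have tE : th * t1 = (1 - th) * t2 by rewrite thE /th; field; exact: lt0r_neq0.
exists ((r1 - m) / t1 + (r2 - m) / t2) => //.
exists (th * t1), (th * r1 + (1 - th) * r2), (th *: x1 + (1 - th) *: x2).
split => //; first exact: convex_ereal_le.
  have -> : (th * t1) *: (z + w) - G (th *: x1 + (1 - th) *: x2) =
      th *: (t1 *: z - G x1) + (1 - th) *: (t2 *: w - G x2).
    rewrite !scalerBr !scalerA -tE scalerDr [G (_ + _)]linearD.
    by rewrite ![G (_ *: _)]linearZ opprD addrACA.
  by have /andP[? ?] := th01; apply: PD; apply: PZ => //; rewrite subr_ge0.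
by rewrite thE /th; field; rewrite !lt0r_neq0.
Qed.

Let Qscale (s : R) z a : 0 < s -> Q z a -> exists2 c, Q (s *: z) c & c <= s * a.
Proof.
move=> s0 [t [r [x [t0 xr Pz ->]]]]; exists (s * ((r - m) / t)) => //.
exists (t / s), r, x; split=> //; first exact: divr_gt0.
  by rewrite scalerA divfK ?gt_eqF.
by field; rewrite !lt0r_neq0.
Qed.

Let Q_ge0 a : Q 0 a -> 0 <= a.
Proof.
move=> [t [r [x [t0 xr]]]]; rewrite scaler0 sub0r => /m_le mx ->.
by apply: divr_ge0; rewrite ?(ltW t0)// subr_ge0 -lee_fin (le_trans mx).
Qed.

(** Strong duality for the minimisation of phi under the conic constraint
    - G x in P, where m is a lower bound of the minimum.  The Slater point x0
    bounds the directional derivative from above on the unit ball, so a linear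
    functional below it is continuous; its opposite is the multiplier. *)
Theorem slater_multiplier (x0 : X) (r0 eps : R) :
  (phi x0 <= r0%:E)%E -> 0 < eps ->
  (forall z, `|z| <= eps -> P (z - G x0)) ->
  exists mu : dual Z, (forall z, P z -> 0 <= pairing mu z) /\
    forall x r, (phi x <= r%:E)%E -> m <= r + pairing mu (G x).
Proof.
move=> x0r0 eps0 slater.
have Qball z (c : R) : 0 < c -> `|z| <= c -> Q z ((r0 - m) / eps * c).
  move=> c0 zc; exists (eps / c), r0, x0; split => //.
  - exact: divr_gt0.
  - apply: slater; rewrite normrZ ger0_norm ?divr_ge0 ?(ltW c0) ?(ltW eps0)//.
    by rewrite -mulrA ler_piMr ?(ltW eps0)// mulrC ler_pdivrMr// mul1r.
  - by field; rewrite !lt0r_neq0.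
have Qn z : Q z !=set0.
  exists ((r0 - m) / eps * (`|z| + 1)).
  by apply: Qball; rewrite ?lerDl// ltr_wpDl.
have [sQ leQ] := inf_sublinear Qn Qadd Qscale Q_ge0.
have [g [gD gZ gq]] := hahn_banach_sublinear sQ.
have gQ z a : Q z a -> g z <= a by move=> /leQ; exact: le_trans (gq z).
have g0 : g 0 = 0 by rewrite -(scale0r 0) gZ mul0r.
have gN z : g (- z) = - g z by rewrite -scaleN1r gZ mulN1r.
have gB : exists M : R, forall z, `|- g z| <= M * `|z|.
  exists ((r0 - m) / eps) => z.
  have [->|z0] := eqVneq z 0; first by rewrite g0 oppr0 !normr0 mulr0.
  have nz0 : 0 < `|z| by rewrite normr_gt0.
  rewrite normrN ler_norml lerNl -gN; apply/andP; split; apply/gQ/Qball => //.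
  by rewrite normrN.
have hD z w : - g (z + w) = - g z + - g w by rewrite gD opprD.
have hZ (t : R) z : - g (t *: z) = t * - g z by rewrite gZ mulrN.
exists (dual_of hD hZ gB); split => [z Pz|x r xr]; rewrite dual_ofE.
- rewrite oppr_ge0 leNgt; apply/negP => gz0.
  (* At any time t the point x0 is admissible in the direction z of the cone,
     so that t g(z) stays below r0 - m for all t. *)
  have bnd (t : R) : 0 < t -> t * g z <= r0 - m.
    move=> t0; rewrite mulrC -ler_pdivlMr//; apply: gQ; exists t, r0, x0.
    split => //; apply: PD; first by apply: PZ => //; exact: ltW.
    by rewrite -[X in P X]add0r; apply: slater; rewrite normr0 ltW.
  have rm0 : 0 <= r0 - m.
    have := bnd 1 ltr01; rewrite mul1r; exact: le_trans (ltW gz0).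
  have := bnd ((r0 - m + 1) / g z) _; rewrite divfK ?gt_eqF//.
  by rewrite divr_gt0 ?ltr_wpDl// => /(_ isT); lra.
- have : g (G x) <= (r - m) / 1.
    apply: gQ; exists 1, r, x; split => //.
    rewrite scale1r subrr -(subrr (- G x0)) opprK.
    have := slater 0; rewrite normr0 sub0r => /(_ (ltW eps0)) PG.
    have := PZ (lexx 0) PG; rewrite scale0r => P0.
    by rewrite addrC subrr.
  by rewrite divr1; lra.
Qed.

End slater.

(** * Weak-* compact sublevel sets and linear growth *)

Section coercivity.
Context {R : realType}.

Lemma weak_star_cvg_pairing (E : normedModType R) (x : nat -> weak_star E)
    (l : weak_star E) (a : E) :
  x @ \oo --> l ->
  (fun n => pairing (x n : dual E) a) @ \oo --> pairing (l : dual E) a.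
Proof.
move=> xl; pose pr (y : weak_star E) : {ptws E -> R} := pairing (y : dual E).
have cpr : continuous pr by exact: initial_continuous.
have cev : continuous (proj a : {ptws E -> R} -> R) by exact: proj_continuous.
have c : {for l, continuous (proj a \o pr)}.
  by apply: continuous_comp; [exact: cpr|exact: cev].
exact: (cvg_comp _ _ xl c).
Qed.

(** The uniform boundedness principle: a weak-* convergent sequence is pointwise
    bounded on a Banach space. *)
Lemma weak_star_cvg_bounded (E : completeNormedModType R)
    (x : nat -> weak_star E) (l : weak_star E) :
  x @ \oo --> l -> exists M : R, forall n, `|x n : dual E| <= M.
Proof.
move=> xl; pose F : set (E -> R^o) := range (fun n => pairing (x n : dual E)).
have [_ [n _ <-]|a|M MF] := @Banach_Steinhauss R E R^o F _ _ 1.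
- split; last exact: blin_is_linear.
  move=> r; exists (`|x n : dual E| * r) => a ar.
  by apply: (le_trans (le_pairing _ _)); exact: ler_wpM2l.
- have /cvg_seq_bounded[M [_ Mb]] := cvgP _ (weak_star_cvg_pairing (a := a) xl).
  exists (M + 1) => _ [n _ <-]; apply: Mb => //; by rewrite ltrDl.
- exists M => n; apply: dual_norm_lub => a a1; apply: MF a1.
  by exists n.
Qed.

(** From an unbounded set one could extract a weak-* convergent sequence whose
    norms tend to infinity. *)
Lemma sequentially_compact_bounded (E : completeNormedModType R)
    (K : set (weak_star E)) :
  sequentially_compact K -> exists M : R, forall w : dual E, K w -> `|w| <= M.
Proof.
move=> cK; apply: contrapT => unbounded.
have /choice[x xP] (n : nat) : exists w : dual E, K w /\ n%:R < `|w|.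
  apply: contrapT => none; apply: unbounded; exists n%:R => w Kw.
  by rewrite leNgt; apply/negP => nw; apply: none; exists w.
have [phi [l _ [phi_incr xl]]] := cK x (fun n => (xP n).1).
have [M xM] := weak_star_cvg_bounded xl.
have le_phi n : (n <= phi n)%N.
  elim: n => // n IHn; exact: leq_ltn_trans IHn (phi_incr _ _ (ltnSn n)).
have [N MN] : exists N : nat, M < N%:R.
  by exists (Num.truncn M).+1; exact: truncnS_gt.
have := lt_le_trans (xP (phi N)).2 (xM N); apply/negP; rewrite -leNgt.
by apply: (le_trans (ltW MN)); rewrite ler_nat.
Qed.

(** Moving from w towards x0 until the excess r over m shrinks to 1 leads into
    the bounded sublevel set of level m + 1, so w is at most 1 + r times as far
    from x0 as that set reaches. *)
Lemma convex_linear_growth (E : normedModType R) (F : E -> \bar R)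
    (x0 : E) (m M : R) :
  convex_ereal F -> (F x0 <= m%:E)%E ->
  (forall w, (F w <= (m + 1)%:E)%E -> `|w| <= M) ->
  exists2 C : R, 0 <= C &
    forall w r, 0 <= r -> (F w <= (m + r)%:E)%E -> `|w| <= C * (1 + r).
Proof.
move=> Fc Fx0 FM; exists (M + `|x0| + `|x0|).
  rewrite !addr_ge0// (le_trans (normr_ge0 x0))// FM// (le_trans Fx0)//.
  by rewrite lee_fin lerDl.
move=> w r r0 Fw; have d0 : 0 < 1 + r by rewrite ltr_pwDl.
have t01 : 0 <= (1 + r)^-1 <= 1.
  by rewrite invr_ge0 (ltW d0)/= invf_le1// lerDl.
have /FM : (F ((1 + r)^-1 *: w + (1 - (1 + r)^-1) *: x0)%R <= (m + 1)%:E)%E.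
  apply: (le_trans (convex_ereal_le Fc t01 Fw Fx0)); rewrite lee_fin.
  have -> : (1 + r)^-1 * (m + r) + (1 - (1 + r)^-1) * m = m + r / (1 + r).
    by field; exact: lt0r_neq0.
  by rewrite lerD2l ler_pdivrMr// mul1r lerDr.
set z := _ + _ => zM.
have -> : w = (1 + r) *: (z - x0) + x0.
  rewrite /z scalerBl scale1r addrA addrAC addrK -scalerBr scalerA.
  by rewrite mulfV ?gt_eqF// scale1r subrK.
apply: (le_trans (ler_normD _ _)); rewrite normrZ gtr0_norm//.
have : (1 + r) * `|z - x0| <= (1 + r) * (M + `|x0|).
  by rewrite ler_pM2l// (le_trans (ler_normB _ _))// lerD2r.
have : 0 <= r * `|x0| by rewrite mulr_ge0.
by rewrite !mulrDl !mulrDr !mulr1; lra.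
Qed.

End coercivity.

(** * Positive functionals and operators *)

Section positive_functionals_and_operators.
Context {R : realType}.

(** For an x of arbitrary sign, S x lies between - T |x| and T |x|, and the norm
    is monotone for the lattice order; this is how operator inequalities, which
    speak of nonnegative arguments, bound errors at every x. *)
Lemma dominated_norm_le (L N : banachLatticeType R)
    (S T : boundedLinear L N) (x : L) :
  op_le (fun=> 0) S -> op_le S T -> `|S x| <= `|T| * `|x|.
Proof.
move=> S0 ST; apply: (@le_trans _ _ `|T (labs x)|); last first.
  by rewrite -(norm_labs x); exact: le_op_norm.
have mono y z : y <=L z -> S y <=L S z.
  move=> /lle_subr0/S0; rewrite linearB => ?; exact/lle_subr0.
have STx : S (labs x) <=L T (labs x) by apply: ST; exact: labs_ge0.
apply: lnorm_mono; last exact: lle_trans (mono _ _ (labs_ge x)) STx.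
have -> : S x = - S (- x) by rewrite linearN opprK.
apply: lle_opp.
exact: lle_trans (mono _ _ (labs_geN x)) STx.
Qed.

Lemma pairing_Estar (L : banachLatticeType R)
    (mu : dual (dual L) * dual (dual L)) (x : dual L) :
  pairing (Estar mu) x = pairing mu.1 x - pairing mu.2 x.
Proof. by rewrite /pairing/= /pairing/= linearN. Qed.

Lemma pairing_Bstar (L N : banachLatticeType R)
    (S T : boundedLinear (dual L) (dual N))
    (mu : dual (dual N) * dual (dual N)) (x : dual L) :
  pairing (Bstar S T mu) x = pairing mu.1 (S x) - pairing mu.2 (T x).
Proof. by rewrite /pairing/= /pairing/= linearN. Qed.

Lemma pairing_mono (L : banachLatticeType R) (p : dual L) (x y : L) :
  0 <=L p -> x <=L y -> pairing p x <= pairing p y.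
Proof.
move=> p0 /lle_subr0 xy; rewrite -subr_ge0 -pairingBr.
by have := p0 _ xy; rewrite pairing0l.
Qed.

End positive_functionals_and_operators.

(** * Rates from the bound on the gap *)

Section rates.
Context {R : realType}.
Implicit Types (lambda K C alpha delta eta t s h : R).

Lemma ereal_bigO_le (D : nat -> \bar R) (g : nat -> R) (C : R) :
  (forall n, D n \is a fin_num) -> (forall n, 0 <= fine (D n)) ->
  (\forall n \near \oo, fine (D n) <= C * g n) -> ereal_bigO D g.
Proof.
move=> Dfin D0 Dg; split; first by near=> n; exact: Dfin.
apply/eqO_exP; exists (`|C| + 1); first by rewrite ltr_wpDl.
near=> n; rewrite ger0_norm//; apply: (@le_trans _ _ (C * g n)).
  by near: n.
rewrite (le_trans (ler_norm _))// normrM ler_wpM2r// lerDl//.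
Unshelve. all: by end_near. Qed.

Lemma powR_root_le lambda delta s : 1 <= lambda -> 0 <= s ->
  lambda^-1 * s `^ lambda <= delta ->
  s <= lambda `^ lambda^-1 * delta `^ lambda^-1.
Proof.
move=> l1 s0 sd; have l0 : 0 < lambda by lra.
have d0 : 0 <= delta.
  by apply: le_trans sd; rewrite mulr_ge0 ?powR_ge0 ?invr_ge0 ?ltW.
have li0 : 0 <= lambda^-1 by rewrite invr_ge0 ltW.
rewrite -powRM ?(ltW l0)//.
have {1}-> : s = (s `^ lambda) `^ lambda^-1.
  by rewrite -powRrM mulfV ?gt_eqF// powRr1.
apply: ge0_ler_powR; rewrite ?nnegrE ?powR_ge0 ?mulr_ge0 ?(ltW l0)//.
by rewrite -ler_pdivrMl.
Qed.

(** Young's inequality for the product of K alpha and t, with exponents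
    lambda / (lambda - 1) and lambda, divided by alpha. *)
Lemma young_penalty lambda K alpha t : 1 < lambda -> 0 <= K -> 0 < alpha ->
  0 <= t ->
  K * t - lambda^-1 * t `^ lambda / alpha <=
    (lambda / (lambda - 1))^-1 * K `^ (lambda / (lambda - 1)) *
      alpha `^ (lambda - 1)^-1.
Proof.
move=> l1 K0 a0 t0; set q := lambda / (lambda - 1).
have l10 : 0 < lambda - 1 by rewrite subr_gt0.
have q0 : 0 < q by rewrite divr_gt0//; lra.
have qE : (lambda - 1)^-1 = q - 1 by rewrite /q; field; exact: lt0r_neq0.
have conj : q^-1 + lambda^-1 = 1.
  by rewrite /q; field; rewrite !lt0r_neq0//; lra.
have l0 : 0 < lambda by lra.
have := @conjugate_powR R (K * alpha) t q lambda
  (mulr_ge0 K0 (ltW a0)) t0 q0 l0 conj.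
rewrite powRM ?(ltW a0)// -(mulr_powRB1 (ltW a0) q0) -qE => young.
rewrite lerBlDr -(ler_pM2l a0) mulrDr [alpha * (_ / alpha)]mulrC divfK ?gt_eqF//.
move: young; rewrite mulrAC [K * t * _]mulrC => /le_trans; apply.
rewrite le_eqVlt; apply/orP; left; apply/eqP; field.
by rewrite !lt0r_neq0.
Qed.

Section sequences.
(* Here h, t and s stand for H(v_n | f_n), |v_n - f_n| and |fbar - f_n|, d for a
   Bregman distance and K for the norm of E^* mu.  In d_le the last term is the
   operator error: eta times the linear growth bound on |u_n|. *)
Variables (lambda K C : R) (alpha delta eta h t s d : nat -> R).
Hypotheses (lambda_ge1 : 1 <= lambda) (K_ge0 : 0 <= K) (C_ge0 : 0 <= C).
Hypothesis alpha_gt0 : forall n, 0 < alpha n.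
Hypothesis eta_ge0 : forall n, 0 <= eta n.
Hypothesis eta_cvg0 : eta @ \oo --> (0 : R).
Hypotheses (t_ge0 : forall n, 0 <= t n) (s_ge0 : forall n, 0 <= s n).
Hypothesis th : forall n, lambda^-1 * t n `^ lambda <= h n.
Hypothesis sdelta : forall n, lambda^-1 * s n `^ lambda <= delta n.
Hypothesis d_le : forall n, d n <= delta n / alpha n - h n / alpha n +
  K * t n + K * s n + C * eta n * (1 + delta n / alpha n).

Let lambda_gt0 : 0 < lambda. Proof. exact: lt_le_trans ltr01 _. Qed.

Let delta_ge0 n : 0 <= delta n.
Proof.
by apply: le_trans (sdelta n); rewrite mulr_ge0 ?powR_ge0 ?invr_ge0 ?ltW.
Qed.

Let ratio_ge0 n : 0 <= delta n / alpha n.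
Proof. by rewrite divr_ge0// ltW. Qed.

(* The product eta delta / alpha is absorbed by delta / alpha once eta <= 1; b
   is what remains of K t after the fidelity term has been used. *)
Let d_le_near (b : nat -> R) : (forall n, 0 <= b n) ->
  (\forall n \near \oo, K * t n - lambda^-1 * t n `^ lambda / alpha n <= b n) ->
  \forall n \near \oo, d n <= (1 + C) * (delta n / alpha n) + b n +
    K * lambda `^ lambda^-1 * delta n `^ lambda^-1 + C * eta n.
Proof.
move=> b0 Hb; near=> n.
have eta1 : eta n <= 1 by near: n; exact: (cvgr_le 0 eta_cvg0 _ ltr01).
have bn : K * t n - lambda^-1 * t n `^ lambda / alpha n <= b n by near: n.
have hn : lambda^-1 * t n `^ lambda / alpha n <= h n / alpha n.
  by rewrite ler_pM2r ?invr_gt0.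
have sn : K * s n <= K * lambda `^ lambda^-1 * delta n `^ lambda^-1.
  by rewrite -mulrA ler_wpM2l// powR_root_le.
have en : C * eta n * (delta n / alpha n) <= C * (delta n / alpha n).
  by rewrite ler_wpM2r// ler_piMr.
have := d_le n; rewrite [C * eta n * (1 + _)]mulrDr mulr1 [(1 + C) * _]mulrDl.
lra.
Unshelve. all: by end_near. Qed.

Lemma rate_gt1 : 1 < lambda -> exists2 C', 0 <= C' &
  \forall n \near \oo, d n <= C' * (delta n / alpha n +
    alpha n `^ (lambda - 1)^-1 + delta n `^ lambda^-1 + eta n).
Proof.
move=> l1; set q := lambda / (lambda - 1).
have q0 : 0 < q by rewrite divr_gt0// subr_gt0.
pose c1 := q^-1 * K `^ q; pose c2 := K * lambda `^ lambda^-1.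
have c10 : 0 <= c1 by rewrite mulr_ge0 ?powR_ge0 ?invr_ge0 ?ltW.
have c20 : 0 <= c2 by rewrite mulr_ge0 ?powR_ge0.
exists (1 + C + c1 + c2) => [|]; first by rewrite !addr_ge0.
have := @d_le_near (fun n => c1 * alpha n `^ (lambda - 1)^-1).
move=> /(_ (fun n => mulr_ge0 c10 (powR_ge0 _ _))) H.
near=> n.
have dn : d n <= (1 + C) * (delta n / alpha n) + c1 * alpha n `^ (lambda - 1)^-1
    + c2 * delta n `^ lambda^-1 + C * eta n.
  near: n; apply: H; near=> n; exact: young_penalty.
apply: (le_trans dn).
have r0 := ratio_ge0 n; have e0 := eta_ge0 n.
have a0 := powR_ge0 (alpha n) (lambda - 1)^-1.
have dd0 := powR_ge0 (delta n) lambda^-1.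
have : 0 <= (c1 + c2) * (delta n / alpha n) by rewrite mulr_ge0// addr_ge0.
have : 0 <= (1 + C + c2) * alpha n `^ (lambda - 1)^-1.
  by rewrite mulr_ge0// !addr_ge0.
have : 0 <= (1 + C + c1) * delta n `^ lambda^-1 by rewrite mulr_ge0// !addr_ge0.
have : 0 <= (1 + c1 + c2) * eta n by rewrite mulr_ge0// !addr_ge0.
by rewrite !mulrDr !mulrDl; lra.
Unshelve. all: by end_near. Qed.

Lemma rate_eq1 : lambda = 1 -> (\forall n \near \oo, K * alpha n <= 1) ->
  exists2 C', 0 <= C' & \forall n \near \oo,
    d n <= C' * (delta n / alpha n + delta n + eta n).
Proof.
move=> l1 Ka; exists (1 + C + K) => [|]; first by rewrite !addr_ge0.
have H := @d_le_near (fun=> 0) (fun=> lexx 0).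
near=> n.
have dn : d n <= (1 + C) * (delta n / alpha n) + 0
    + K * lambda `^ lambda^-1 * delta n `^ lambda^-1 + C * eta n.
  near: n; apply: H; near=> n.
  rewrite l1 invr1 powRr1// mul1r subr_le0 ler_pdivlMr// mulrAC.
  by rewrite ler_piMl//; near: n.
apply: (le_trans dn).
rewrite l1 invr1 powR1 mulr1 powRr1 ?delta_ge0// addr0.
have r0 := ratio_ge0 n; have e0 := eta_ge0 n; have d0 := delta_ge0 n.
have : 0 <= K * (delta n / alpha n) by rewrite mulr_ge0.
have : 0 <= (1 + C) * delta n by rewrite mulr_ge0// !addr_ge0.
have : 0 <= (1 + K) * eta n by rewrite mulr_ge0// !addr_ge0.
by rewrite !mulrDr !mulrDl; lra.
Unshelve. all: by end_near. Qed.

Variable D : nat -> \bar R.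
Hypotheses (D_d : forall n, D n = (d n)%:E) (d_ge0 : forall n, 0 <= d n).

Let bigO_D C' g : (\forall n \near \oo, d n <= C' * g n) -> ereal_bigO D g.
Proof.
move=> dg; apply: (@ereal_bigO_le _ _ C') => [n|n|]; rewrite ?D_d//=.
by apply: filterS dg => n; rewrite D_d.
Qed.

Lemma bregman_general_rate :
  alpha @ \oo --> (0 : R) -> general_rate lambda alpha delta eta D.
Proof.
move=> alpha0; split=> [l1|l1]; first by have [C' _ /bigO_D] := rate_gt1 l1.
have [|C' _ /bigO_D//] := rate_eq1 l1.
have : (fun n => K * alpha n) @ \oo --> K * 0.
  by apply: cvgM => //; exact: cvg_cst.
by rewrite mulr0 => Ka0; exact: (cvgr_le 0 Ka0 _ ltr01).
Qed.

(** For lambda > 1 the choice of alpha makes delta / alpha and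
    alpha^(1/(lambda-1)) both comparable to delta^(1/lambda).  For lambda = 1
    the constant alpha keeps K alpha <= 1, and delta / alpha is a multiple of
    delta. *)
Lemma bregman_optimal_rate :
  parameter_choice lambda K alpha delta -> optimal_rate lambda delta eta D.
Proof.
move=> [choice_gt1 choice_eq1].
move: lambda_ge1; rewrite le_eqVlt => /predU1P[/esym l1|l1].
  have [c alphaE cK] := choice_eq1 l1.
  have c0 : 0 < c by rewrite -(alphaE 0%N).
  have Kc : K * c <= 1.
    move: K_ge0; rewrite le_eqVlt => /predU1P[<-|K0]; first by rewrite mul0r.
    move: cK; rewrite inver gt_eqF// lee_fin => cK.
    by rewrite mulrC -ler_pdivlMr// mul1r.
  have [|C' C'0 dC'] := rate_eq1 l1; first by near=> n; rewrite alphaE.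
  apply: (@bigO_D (C' * (c^-1 + 1))); near=> n.
  have /le_trans : d n <= C' * (delta n / alpha n + delta n + eta n) by near: n.
  apply; rewrite alphaE l1 invr1 powRr1// -mulrA ler_wpM2l//.
  have ic : 0 <= c^-1 * eta n by rewrite mulr_ge0// invr_ge0 ltW.
  by rewrite mulrDl !mulrDr; lra.
have [c [c' [c0 c'0 cc']]] := choice_gt1 l1.
have l10 : 0 < lambda - 1 by rewrite subr_gt0.
set ex := (lambda - 1) / lambda in cc'.
have ex0 : ex != 0 by rewrite mulf_neq0 ?invr_neq0 ?gt_eqF.
have pd n : 0 < delta n `^ ex.
  rewrite lt_neqAle powR_ge0 andbT; apply/eqP => dth.
  by have := cc' n; rewrite -dth invr0 mulr0 leNgt c0.
have dE n : delta n = delta n `^ ex * delta n `^ lambda^-1.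
  have -> : lambda^-1 = 1 - ex by rewrite /ex; field; exact: lt0r_neq0.
  rewrite -powRD; first by rewrite addrC subrK powRr1.
  by apply/implyP => _; have := pd n; rewrite lt0r powR_eq0 ex0 andbT => /andP[].
have ratio n : delta n / alpha n <= c^-1 * delta n `^ lambda^-1.
  rewrite ler_pdivrMr// {1}dE mulrAC ler_wpM2r ?powR_ge0//.
  rewrite ler_pdivlMl// -ler_pdivlMr//.
  by have /andP[] := cc' n.
have al n : alpha n `^ (lambda - 1)^-1 <=
    c' `^ (lambda - 1)^-1 * delta n `^ lambda^-1.
  have -> : lambda^-1 = ex * (lambda - 1)^-1.
    by rewrite /ex; field; rewrite !lt0r_neq0.
  rewrite powRrM -powRM ?powR_ge0 ?(ltW c'0)//.
  apply: ge0_ler_powR.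
  - by rewrite invr_ge0 ltW.
  - by rewrite nnegrE ltW.
  - by rewrite nnegrE mulr_ge0 ?powR_ge0// ltW.
  by rewrite -ler_pdivrMr//; have /andP[] := cc' n.
have [C' C'0 dC'] := rate_gt1 l1.
apply: (@bigO_D (C' * (c^-1 + c' `^ (lambda - 1)^-1 + 1))); near=> n.
have /le_trans : d n <= C' * (delta n / alpha n + alpha n `^ (lambda - 1)^-1 +
    delta n `^ lambda^-1 + eta n) by near: n.
apply; rewrite -mulrA ler_wpM2l//.
have := ratio n; have := al n.
have : 0 <= (c^-1 + c' `^ (lambda - 1)^-1) * eta n.
  by rewrite mulr_ge0// addr_ge0 ?powR_ge0 ?invr_ge0 ?ltW.
by rewrite !mulrDr !mulrDl; lra.
Unshelve. all: by end_near. Qed.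

End sequences.
End rates.

(** * Duality for the two-sided constrained problem *)

Section duality.
Context {R : realType}.
Local Open Scope ereal_scope.

Lemma finite_at (T : Type) (F : T -> \bar R) (x : T) (a : R) :
  (forall y, -oo < F y) -> F x <= a%:E -> F x = (fine (F x))%:E.
Proof.
move=> Fgt Fx; rewrite fineK// fin_numE -ltNye Fgt/= -ltey.
exact: le_lt_trans Fx (ltry _).
Qed.

Lemma proper_function_point (E : normedModType R) (F : E -> \bar R) :
  proper_function F -> exists x (a : R), F x = a%:E.
Proof.
move=> [Fgt [x Fx]]; exists x, (fine (F x)).
by rewrite fineK// fin_numE -ltNye Fgt/= -ltey.
Qed.

Lemma subdifferential_fin_num (E : normedModType R) (F : E -> \bar R) x p :
  proper_function F -> subdifferential F x p -> F x = (fine (F x))%:E.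
Proof.
move=> Fproper Fp; have [y [a Fy]] := proper_function_point Fproper.
apply: (@finite_at _ _ _ (a - pairing p (y - x))%R); first by case: Fproper.
by rewrite EFinB leeBrDr// -Fy; exact: Fp.
Qed.

Lemma conjugate_ge (E : normedModType R) (F : E -> \bar R) p x (a : R) :
  F x = a%:E -> (pairing p x - a)%:E <= conjugate F p.
Proof. by move=> Fx; apply: ereal_sup_ubound; exists x => //; rewrite Fx. Qed.

Lemma conjugate_le (E : normedModType R) (F : E -> \bar R) p (c : R) :
  (forall x, -oo < F x) ->
  (forall x (a : R), F x = a%:E -> (pairing p x - a <= c)%R) ->
  conjugate F p <= c%:E.
Proof.
move=> Fgt Fc; apply: ge_ereal_sup => _ [x _ <-].
have := Fgt x; case E1 : (F x) => [a| |]// _; last by rewrite leNye.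
by rewrite -EFinB lee_fin; exact: Fc.
Qed.

(** The ball of radius eps lies in the order interval [- eps e, eps e]: this
    turns the strict feasibility condition into a Slater condition for the
    norm. *)
Lemma order_unit_ge (L : banachLatticeType R) (e z : L) (eps : R) :
  order_unit e -> (0 < eps)%R -> (`|z| <= eps)%R -> (- z <=L eps *: e)%R.
Proof.
move=> [_ _ eP] eps0 zeps; apply/lle_subr0; rewrite opprK.
have -> : (eps *: e + z = eps *: (e - - (eps^-1 *: z)))%R.
  by rewrite opprK scalerDr scalerA mulfV ?gt_eqF// scale1r.
apply: lscale_ge0; first exact: ltW.
apply: (lle_subr0 _ _).1; apply: (lle_trans (labs_geN _)); apply: eP.
by rewrite normrZ gtr0_norm ?invr_gt0// mulrC ler_pdivrMr// mul1r.
Qed.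

Section problem.
Variables (U V : banachLatticeType R).
Variables (J : dual U -> \bar R) (H : dual V -> dual V -> \bar R).
Variables (Al Au : boundedLinear (dual U) (dual V)).
Variables (alpha : R) (f : dual V).
Hypothesis alpha_gt0 : (0 < alpha)%R.
Hypothesis J_proper : proper_function J.
Hypothesis H_proper : proper_function (H ^~ f).
Implicit Types (mu : dual (dual V) * dual (dual V)).

(** The pairing of mu with the constraint residual B_n u - E v. *)
Definition lagrangian_term mu (u : dual U) (v : dual V) : R :=
  (pairing mu.1 (Al u - v) + pairing mu.2 (v - Au u))%R.

Let lagrangian_termE mu u v : lagrangian_term mu u v =
  (- pairing (- Bstar Al Au mu)%R u - pairing (Estar mu) v)%R.
Proof.
rewrite /lagrangian_term pairingNl pairing_Bstar pairing_Estar !pairingBr.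
by ring.
Qed.

Let lagrangian_term_primal mu u u' v : lagrangian_term mu u' v =
  (lagrangian_term mu u v - pairing (- Bstar Al Au mu) (u' - u))%R.
Proof.
rewrite !lagrangian_termE pairingBr.
by move: (pairing _ u) (pairing _ u') (pairing _ v) => a b c; ring.
Qed.

Let lagrangian_term_fidelity mu u v v' : lagrangian_term mu u v' =
  (lagrangian_term mu u v - pairing (Estar mu) (v' - v))%R.
Proof.
rewrite !lagrangian_termE pairingBr.
by move: (pairing _ u) (pairing _ v) (pairing _ v') => a b c; ring.
Qed.

Lemma lagrangian_term_le0 mu u v : nonneg_pair mu -> feasible Al Au u v ->
  (lagrangian_term mu u v <= 0)%R.
Proof.
move=> [mu1 mu2] [uv vu]; rewrite /lagrangian_term !pairingBr.
by rewrite -[leRHS]addr0; apply: lerD; rewrite subr_le0; exact: pairing_mono.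
Qed.

Lemma dual_objective_le mu u v (h j : R) : H v f = h%:E -> J u = j%:E ->
  dual_objective J H Al Au alpha f mu <=
    (alpha^-1 * h + j + lagrangian_term mu u v)%:E.
Proof.
move=> Hv Ju; have cJ := conjugate_ge (- Bstar Al Au mu)%R Ju.
have cH := @conjugate_ge _ (H ^~ f) (alpha *: Estar mu)%R v h Hv.
have -> : (alpha^-1 * h + j + lagrangian_term mu u v)%:E =
    - (alpha^-1%:E * (pairing (alpha *: Estar mu)%R v - h)%:E) -
      (pairing (- Bstar Al Au mu)%R u - j)%:E.
  rewrite -EFinM -EFinN -EFinB; congr EFin.
  by rewrite lagrangian_termE pairingZl; field; exact: lt0r_neq0.
apply: leeD; rewrite leeN2//.
by apply: lee_wpmul2l => //; rewrite lee_fin invr_ge0 ltW.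
Qed.

(** The dual objective is the infimum of the Lagrangian, with the conjugates
    possibly infinite.  A lower bound m on the Lagrangian makes both conjugates
    finite: each is bounded above through a point in the domain of the other
    function. *)
Lemma dual_objective_ge mu (m : R) :
  (forall u v (h j : R), H v f = h%:E -> J u = j%:E ->
    (m <= alpha^-1 * h + j + lagrangian_term mu u v)%R) ->
  m%:E <= dual_objective J H Al Au alpha f mu.
Proof.
move=> mL; have [u0 [j0 Ju0]] := proper_function_point J_proper.
have [v0 [h0 Hv0]] := proper_function_point H_proper.
have J_le v (h : R) : H v f = h%:E -> conjugate J (- Bstar Al Au mu)%R <=
    (- m + alpha^-1 * h - pairing (Estar mu) v)%:E.
  move=> Hv; apply: conjugate_le => [|u j Ju]; first by case: J_proper.
  by have := mL _ _ _ _ Hv Ju; rewrite lagrangian_termE; lra.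
have cJ_fin : conjugate J (- Bstar Al Au mu)%R \is a fin_num.
  rewrite fin_numE -ltNye -ltey (le_lt_trans (J_le _ _ Hv0) (ltry _)) andbT.
  exact: lt_le_trans (ltNyr _) (conjugate_ge _ Ju0).
set c := fine (conjugate J (- Bstar Al Au mu)%R).
have cE : conjugate J (- Bstar Al Au mu)%R = c%:E by rewrite fineK.
have H_le : conjugate (H ^~ f) (alpha *: Estar mu)%R <= (alpha * (- m - c))%:E.
  apply: conjugate_le => [|v h Hv]; first by case: H_proper.
  have := J_le _ _ Hv; rewrite cE lee_fin pairingZl => cm.
  rewrite -(ler_pM2l (_ : 0 < alpha^-1)%R) ?invr_gt0// mulrBr !mulrA.
  rewrite mulVf ?gt_eqF// !mul1r; move: cm.
  move: (pairing _ v) (alpha^-1 * h)%R (c).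
  by move=> a b c'; lra.
have cH_fin : conjugate (H ^~ f) (alpha *: Estar mu)%R \is a fin_num.
  rewrite fin_numE -ltNye -ltey (le_lt_trans H_le (ltry _)) andbT.
  exact: lt_le_trans (ltNyr _) (@conjugate_ge _ (H ^~ f) _ _ _ Hv0).
move: H_le; rewrite /dual_objective cE -(fineK cH_fin); set d := fine _.
rewrite -EFinM -EFinN -EFinB !lee_fin mulrC -ler_pdivrMr// mulrC.
by rewrite -opprD lerNr lerBrDr.
Qed.

Hypothesis J_convex : convex_ereal J.
Hypothesis J_ge0 : forall u, 0 <= J u.
Hypothesis H_ge0 : forall v, 0 <= H v f.
Hypothesis H_convex : convex_ereal (H ^~ f).
Variables (u : dual U) (v : dual V) (h j : R).
Hypotheses (Hv : H v f = h%:E) (Ju : J u = j%:E).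
Hypothesis uv_sol : primal_solution J H Al Au alpha f u v.

(** Weak duality: the Lagrangian term of a feasible point is nonpositive, so no
    dual value exceeds the primal optimum. *)
Lemma multiplier_dual_solution mu : nonneg_pair mu ->
  (alpha^-1 * h + j)%:E <= dual_objective J H Al Au alpha f mu ->
  dual_solution J H Al Au alpha f mu.
Proof.
move=> mu0 mu_opt; split => // nu [nu1 nu2]; apply: le_trans mu_opt.
apply: (le_trans (dual_objective_le nu Hv Ju)); rewrite lee_fin gerDl.
by apply: lagrangian_term_le0 => //; exact: uv_sol.1.
Qed.

(** Without duality gap the optimal value is a lower bound of the Lagrangian of
    mu.  At (u, v) itself this forces complementary slackness;
    varying u or v alone gives the two subgradient conditions. *)
Lemma dual_optimality mu : nonneg_pair mu ->
  (alpha^-1 * h + j)%:E <= dual_objective J H Al Au alpha f mu ->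
  [/\ lagrangian_term mu u v = 0%R,
      subdifferential J u (- Bstar Al Au mu)%R &
      forall w (k : R), H w f = k%:E ->
        (alpha^-1 * h + pairing (Estar mu) (w - v) <= alpha^-1 * k)%R].
Proof.
move=> mu_ge0 mu_opt.
have L_min u' v' (h' j' : R) : H v' f = h'%:E -> J u' = j'%:E ->
    (alpha^-1 * h + j <= alpha^-1 * h' + j' + lagrangian_term mu u' v')%R.
  move=> Hv' Ju'; rewrite -lee_fin (le_trans mu_opt)//.
  exact: dual_objective_le.
have slack : lagrangian_term mu u v = 0%R.
  apply/eqP; rewrite eq_le (lagrangian_term_le0 mu_ge0 uv_sol.1)/=.
  by have := L_min _ _ _ _ Hv Ju; rewrite lerDl.
split => // [u'|w k Hw].
- have [Jgt _] := J_proper.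
  have := Jgt u'; case E1 : (J u') => [j'| |]// _; last by rewrite leey.
  have := L_min _ _ _ _ Hv E1.
  rewrite Ju -EFinD lee_fin (lagrangian_term_primal _ u) slack sub0r.
  by rewrite -addrA lerD2l lerBrDr.
- have := L_min _ _ _ _ Hw Ju.
  rewrite (lagrangian_term_fidelity _ _ v) slack sub0r.
  by rewrite addrAC lerD2r lerBrDr.
Qed.

(** The step that makes the symmetric distance no worse than the one-sided one:
    J does not occur in the bound. *)
Lemma dual_subgradient_gap mu u' v' (k : R) : nonneg_pair mu ->
  (alpha^-1 * h + j)%:E <= dual_objective J H Al Au alpha f mu ->
  feasible Al Au u' v' -> H v' f = k%:E ->
  (pairing (- Bstar Al Au mu) (u - u') <= alpha^-1 * k - alpha^-1 * h)%R.
Proof.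
move=> mu_ge0 mu_opt u'v' Hv'.
have [slack _ /(_ _ _ Hv')] := dual_optimality mu_ge0 mu_opt.
have := lagrangian_term_le0 mu_ge0 u'v'.
rewrite (lagrangian_term_primal _ u) (lagrangian_term_fidelity _ _ v) slack.
rewrite -(opprB u' u) pairingNr sub0r subr_le0 lerBrDl => gap opt.
by apply: le_trans opt; rewrite lerD2l lerNl.
Qed.

Let X := (dual U * dual V)%type.
Let Z := (dual V * dual V)%type.
Let phi (x : X) : \bar R := primal_objective J H alpha f x.1 x.2.
Let residual (x : X) : Z := (Al x.1 - x.2, x.2 - Au x.1)%R.

Let residual_linear : linear residual.
Proof.
have scaleBD (E : lmodType R) (t : R) (a b c d : E) :
    (t *: a + b - (t *: c + d) = t *: (a - c) + (b - d))%R.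
  by rewrite scalerBr opprD addrACA.
move=> t x y; congr pair => /=.
  by rewrite [Al _]linearP scaleBD.
by rewrite [Au _]linearP scaleBD.
Qed.

Let phi_convex : convex_ereal phi.
Proof.
move=> x y t t01; have /andP[t0 t1] := t01.
have a0 : 0 <= (alpha^-1)%:E by rewrite lee_fin invr_ge0 ltW.
have t'0 : (0 <= 1 - t)%R by rewrite subr_ge0.
have distr (s : R) (z : X) : (0 <= s)%R -> s%:E * phi z =
    alpha^-1%:E * (s%:E * H z.2 f) + s%:E * J z.1.
  by move=> s0; rewrite /phi ge0_muleDr ?mule_ge0// muleCA.
rewrite !distr// addeACA -ge0_muleDr; first last.
- by rewrite mule_ge0 ?lee_fin.
- by rewrite mule_ge0 ?lee_fin.
by apply: leeD; [apply: lee_wpmul2l => //; exact: H_convex|exact: J_convex].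
Qed.

(** The two inequality constraints form one conic constraint in the product of
    two copies of the dual of V; the two components of its multiplier, a
    functional on that product, are the dual variables. *)
Lemma strong_duality (e : dual V) : order_unit e ->
  strictly_feasible J H Al Au f e ->
  exists mu, nonneg_pair mu /\
    (alpha^-1 * h + j)%:E <= dual_objective J H Al Au alpha f mu.
Proof.
move=> eP [u0 [v0 [eps [Ju0 Hv0 eps0 lo hi]]]].
pose P : set Z := [set z | 0 <=L z.1 /\ 0 <=L z.2]%R.
pose G : {linear X -> Z} :=
  HB.pack residual (GRing.isLinear.Build R X Z *:%R residual residual_linear).
have PD (z w : Z) : P z -> P w -> P (z + w)%R.
  by move=> [z1 z2] [w1 w2]; split; exact: laddr_ge0.
have PZ (t : R) (z : Z) : (0 <= t)%R -> P z -> P (t *: z)%R.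
  by move=> t0 [z1 z2]; split; exact: lscale_ge0.
have mP (x : X) : P (- G x)%R -> (alpha^-1 * h + j)%:E <= phi x.
  move=> [/= x1 x2]; have := uv_sol.2 x.1 x.2.
  rewrite {1}/primal_objective Hv Ju -EFinM -EFinD; apply; split.
    by apply/lle_subr0; move: x1; rewrite opprB.
  by apply/lle_subr0; move: x2; rewrite opprB.
have [j0 Ju0E] : exists j0 : R, J u0 = j0%:E.
  exists (fine (J u0)).
  by rewrite fineK// fin_numE -ltNye (J_proper.1 u0)/= -ltey.
have [h0 Hv0E] : exists h0 : R, H v0 f = h0%:E.
  exists (fine (H v0 f)).
  by rewrite fineK// fin_numE -ltNye (H_proper.1 v0)/= -ltey.
have phi0 : phi (u0, v0) <= (alpha^-1 * h0 + j0)%:E.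
  by rewrite /phi /primal_objective/= Ju0E Hv0E.
have slater (z : Z) : (`|z| <= eps)%R -> P (z - G (u0, v0))%R.
  rewrite prod_normE ge_max => /andP[z1 z2].
  have fits (d w : dual V) : (`|w| <= eps -> eps *: e <=L - d -> 0 <=L w - d)%R.
    move=> /(order_unit_ge eP eps0) ew ed; rewrite -(subrr w).
    by apply: lleD; [exact: llexx|exact: lle_trans ew ed].
  split; apply: fits => //=; rewrite opprB; apply/lle_subr0.
    by move/lle_subr0: lo; rewrite opprD addrA.
  by move/lle_subr0: hi; rewrite addrAC.
have [nu [nu_pos nu_mult]] :=
  slater_multiplier phi_convex PD PZ mP phi0 eps0 slater.
pose inl (y : dual V) : Z := (y, 0)%R; pose inr (y : dual V) : Z := (0, y)%R.
have inlD y z : inl (y + z)%R = (inl y + inl z)%R.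
  by congr pair; rewrite /= addr0.
have inrD y z : inr (y + z)%R = (inr y + inr z)%R.
  by congr pair; rewrite /= addr0.
have inlZ (t : R) y : inl (t *: y)%R = (t *: inl y)%R.
  by congr pair; rewrite /= scaler0.
have inrZ (t : R) y : inr (t *: y)%R = (t *: inr y)%R.
  by congr pair; rewrite /= scaler0.
have inlB : exists M : R, forall y, (`|inl y| <= M * `|y|)%R.
  by exists 1%R => y; rewrite prod_normE/= normr0 mul1r ge_max lexx/=.
have inrB : exists M : R, forall y, (`|inr y| <= M * `|y|)%R.
  by exists 1%R => y; rewrite prod_normE/= normr0 mul1r ge_max lexx andbT.
pose mu := (adjoint (blin_of inlD inlZ inlB) nu,
            adjoint (blin_of inrD inrZ inrB) nu).
have muE y z : pairing nu (y, z) = (pairing mu.1 y + pairing mu.2 z)%R.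
  by rewrite -[RHS](pairingDr nu); congr pairing; congr pair;
    rewrite /= ?addr0 ?add0r.
exists mu; split.
  have pos (k : dual (dual V)) :
      (forall y, 0 <=L y -> 0 <= pairing k y)%R -> (0 <=L k)%R.
    by move=> k0; change (dual_le 0 k)%R => y y0; rewrite pairing0l; exact: k0.
  split; apply: pos => y y0; apply: nu_pos; split => //; exact: llexx.
apply: dual_objective_ge => // u' v' h' j' Hv' Ju'.
by rewrite /lagrangian_term -muE; apply: (nu_mult (u', v'));
  rewrite /phi /primal_objective/= Hv' Ju'.
Qed.

End problem.
End duality.

(** * The estimates at a fixed index *)

Section estimates.
Context {R : realType} {U V : banachLatticeType R}.
Variables (J : dual U -> \bar R) (H : dual V -> dual V -> \bar R).
Variables (A Al Au : boundedLinear (dual U) (dual V)).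
Variables (alpha : R) (f : dual V).
Implicit Types (mu : dual (dual V) * dual (dual V)).
Hypothesis alpha_gt0 : 0 < alpha.
Hypothesis J_ge0 : forall u, (0 <= J u)%E.
Hypothesis H_ge0 : forall v, (0 <= H v f)%E.
Hypothesis AlA : op_le Al A.
Hypothesis AAu : op_le A Au.

Lemma primal_objective_fin u v (c : R) :
  (primal_objective J H alpha f u v <= c%:E)%E ->
  [/\ H v f = (fine (H v f))%:E, J u = (fine (J u))%:E &
      alpha^-1 * fine (H v f) + fine (J u) <= c].
Proof.
have ai0 : 0 < alpha^-1 by rewrite invr_gt0.
rewrite /primal_objective; have := J_ge0 u; have := H_ge0 v.
case: (H v f) => [h| |]// _; case: (J u) => [j| |]//= _;
  rewrite ?gt0_muley ?lte_fin//.
Qed.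

Lemma primal_solution_le u v w g (delta j : R) :
  primal_solution J H Al Au alpha f u v -> 0 <=L w -> A w = g ->
  (H g f <= delta%:E)%E -> J w = j%:E ->
  (primal_objective J H alpha f u v <= (alpha^-1 * delta + j)%:E)%E.
Proof.
move=> [_ uv_min] w0 Aw Hg Jw; have wg : feasible Al Au w g.
  by rewrite -Aw; split; [exact: AlA|exact: AAu].
apply: (le_trans (uv_min _ _ wg)); rewrite /primal_objective Jw EFinD EFinM.
by rewrite leeD2r// lee_wpmul2l// lee_fin invr_ge0 ltW.
Qed.

Lemma op_le_sub0 (S T : boundedLinear (dual U) (dual V)) :
  op_le S T -> op_le (fun=> 0) (T - S).
Proof. by move=> ST x x0; apply: (lle_subr0 _ _).1; exact: ST. Qed.

Lemma norm_lower_error u : `|A u - Al u| <= `|Au - Al| * `|u|.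
Proof.
apply: (@dominated_norm_le _ _ _ (A - Al) (Au - Al)); first exact: op_le_sub0.
by move=> x x0; apply: lleD2r; exact: AAu.
Qed.

Lemma norm_upper_error u : `|Au u - A u| <= `|Au - Al| * `|u|.
Proof.
apply: (@dominated_norm_le _ _ _ (Au - A) (Au - Al)); first exact: op_le_sub0.
move=> x x0; rewrite -[(Au - A) x]/(Au x - A x) -[(Au - Al) x]/(Au x - Al x).
by apply: lleD; [exact: llexx|apply: lle_opp; exact: AlA].
Qed.

(** After inserting v and f, the remaining A u - v is bounded above by
    (A - A^l) u and v - A u by (A^u - A) u, which is the direction that the
    nonnegativity of mu can use. *)
Lemma source_pairing_le mu u v g (eta : R) : nonneg_pair mu ->
  feasible Al Au u v -> `|Au - Al| <= eta ->
  pairing (Estar mu) (A u - g) <=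
    `|Estar mu| * `|v - f| + `|Estar mu| * `|g - f| +
    (`|mu.1| + `|mu.2|) * eta * `|u|.
Proof.
move=> [mu1 mu2] [lo hi] Aeta.
have -> : A u - g = (v - f) - (g - f) + (A u - v).
  by rewrite opprB [v - f + _]addrA subrK addrCA addrAC subrr add0r.
rewrite pairingDr [in leLHS]pairingBr.
have bound (p : dual (dual V)) (x : dual V) : pairing p x <= `|p| * `|x|.
  exact: le_trans (ler_norm _) (le_pairing _ _).
have boundN (p : dual (dual V)) (x : dual V) : - pairing p x <= `|p| * `|x|.
  by rewrite -pairingNr -(normrN x).
apply: lerD; first by apply: lerD; [exact: bound|exact: boundN].
have err (p : dual (dual V)) (x y : dual V) : 0 <=L p -> x <=L y ->
    `|y| <= `|Au - Al| * `|u| -> pairing p x <= `|p| * eta * `|u|.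
  move=> p0 xy yn; apply: (le_trans (pairing_mono p0 xy)).
  apply: (le_trans (bound _ _)); rewrite -mulrA ler_wpM2l//.
  by apply: (le_trans yn); rewrite ler_wpM2r.
rewrite pairing_Estar -pairingNr opprB !mulrDl; apply: lerD.
- apply: (err _ _ (A u - Al u)) => //; last exact: norm_lower_error.
  by apply: lleD; [exact: llexx|exact: lle_opp].
- apply: (err _ _ (Au u - A u)) => //; last exact: norm_upper_error.
  exact: lleD2r.
Qed.

End estimates.

(** * Convergence rates *)

Theorem theorem3p9 (R : realType) (U V : banachLatticeType R)
  (J : dual U -> \bar R) (H : dual V -> dual V -> \bar R)
  (A : boundedLinear (dual U) (dual V))
  (Al Au : nat -> boundedLinear (dual U) (dual V))
  (fbar : dual V) (f : nat -> dual V)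
  (alpha delta eta : nat -> R) (lambda : R)
  (udag : dual U) (mudag : dual (dual V) * dual (dual V))
  (u : nat -> dual U) (v : nat -> dual V)
  (lambda_ge1 : 1 <= lambda)
  (H_coercive : forall w g : dual V,
    ((lambda^-1 * `|w - g| `^ lambda)%:E <= H w g)%E)
  (J_ge0 : forall w, (0 <= J w)%E)
  (J_proper : proper_function J)
  (J_convex : convex_ereal J)
  (J_lsc : lower_semicontinuous (J : weak_star U -> \bar R))
  (J_compact : forall c : R, [set w | (J w <= c%:E)%E] !=set0 ->
    @sequentially_compact (weak_star U) [set w | (J w <= c%:E)%E])
  (H_ge0 : forall w g, (0 <= H w g)%E)
  (H_proper : forall g, proper_function (H ^~ g))
  (H_convex : forall g, convex_ereal (H ^~ g))
  (H_lsc : lower_semicontinuous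
    ((fun wg => H wg.1 wg.2) : weak_star V * weak_star V -> \bar R))
  (H_eq0 : forall w g, H w g = 0%E <-> w = g)
  (A_regular : regular_op A)
  (A_continuous : weak_star_continuous A)
  (Al_continuous : forall n, weak_star_continuous (Al n))
  (Au_continuous : forall n, weak_star_continuous (Au n))
  (udag_ge0 : 0 <=L udag)
  (udag_sol : A udag = fbar)
  (udag_min : forall w, A w = fbar -> (J udag <= J w)%E)
  (mudag_ge0 : nonneg_pair mudag)
  (source : subdifferential J udag (- Bstar A A mudag))
  (A_bounds : forall n, op_le (Al n) A /\ op_le A (Au n))
  (eta_bound : forall n, `|Au n - Al n| <= eta n)
  (eta_cvg0 : eta @ \oo --> (0 : R))
  (delta_bound : forall n, (H fbar (f n) <= (delta n)%:E)%E)
  (delta_cvg0 : delta @ \oo --> (0 : R))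
  (alpha_gt0 : forall n, 0 < alpha n)
  (uv_sol : forall n,
    primal_solution J H (Al n) (Au n) (alpha n) (f n) (u n) (v n)) :
  let D n := bregman J (- Bstar A A mudag) (u n) udag in
  [/\ alpha @ \oo --> (0 : R) -> general_rate lambda alpha delta eta D,
      parameter_choice lambda `|Estar mudag| alpha delta ->
        optimal_rate lambda delta eta D
    & forall e : dual V, AM_space (dual V) -> order_unit e ->
      (forall n, strictly_feasible J H (Al n) (Au n) (f n) e) ->
      (forall n, exists mu,
        dual_solution J H (Al n) (Au n) (alpha n) (f n) mu) /\
      forall mu : nat -> dual (dual V) * dual (dual V),
        (forall n,
          dual_solution J H (Al n) (Au n) (alpha n) (f n) (mu n)) ->
        let p n := - Bstar (Al n) (Au n) (mu n) in
        let Dsymm n :=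
          (symm_bregman (p n) (- Bstar A A mudag) (u n) udag)%:E in
        [/\ forall n, subdifferential J (u n) (p n),
            alpha @ \oo --> (0 : R) ->
              general_rate lambda alpha delta eta Dsymm
          & parameter_choice lambda `|Estar mudag| alpha delta ->
              optimal_rate lambda delta eta Dsymm]].
Proof.
move=> D; set p := - Bstar A A mudag.
have JudagE := subdifferential_fin_num J_proper source.
set jd := fine (J udag) in JudagE.
have primal_le n : (primal_objective J H (alpha n) (f n) (u n) (v n) <=
    ((alpha n)^-1 * delta n + jd)%:E)%E.
  have [AlA AAu] := A_bounds n.
  exact: (primal_solution_le (alpha_gt0 n) AlA AAu (uv_sol n) udag_ge0
    udag_sol (delta_bound n) JudagE).
pose h n := fine (H (v n) (f n)); pose j n := fine (J (u n)).
have fin n : [/\ H (v n) (f n) = (h n)%:E, J (u n) = (j n)%:E &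
    (alpha n)^-1 * h n + j n <= (alpha n)^-1 * delta n + jd].
  by apply: primal_objective_fin (primal_le n).
pose t n := `|v n - f n|; pose s n := `|fbar - f n|.
have th n : lambda^-1 * t n `^ lambda <= h n.
  by rewrite -lee_fin; have [<- _ _] := fin n; exact: H_coercive.
have sdelta n : lambda^-1 * s n `^ lambda <= delta n.
  by rewrite -lee_fin; exact: le_trans (H_coercive _ _) (delta_bound n).
have t_ge0 n : 0 <= t n by exact: normr_ge0.
have s_ge0 n : 0 <= s n by exact: normr_ge0.
have h_ge0 n : 0 <= h n by rewrite fine_ge0.
have delta_ge0 n : 0 <= delta n.
  by rewrite -lee_fin; exact: le_trans (H_ge0 _ _) (delta_bound n).
have eta_ge0 n : 0 <= eta n by exact: le_trans (eta_bound n).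
have ai_ge0 n : 0 <= (alpha n)^-1 by rewrite invr_ge0 ltW.
have [C0 C0_ge0 growth] : exists2 C : R, 0 <= C & forall w r, 0 <= r ->
    (J w <= (jd + r)%:E)%E -> `|w| <= C * (1 + r).
  have [M Mb] : exists M : R, forall w, (J w <= (jd + 1)%:E)%E -> `|w| <= M.
    apply: (@sequentially_compact_bounded _ U); apply: J_compact.
    by exists udag; rewrite /= JudagE lee_fin lerDl.
  have Jd : (J udag <= jd%:E)%E by rewrite JudagE.
  exact: (convex_linear_growth J_convex Jd Mb).
pose C := (`|mudag.1| + `|mudag.2|) * C0.
have C_ge0 : 0 <= C by rewrite mulr_ge0// addr_ge0.
pose K := `|Estar mudag|.
have gap_le n : delta n / alpha n - h n / alpha n - pairing p (u n - udag) <=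
    delta n / alpha n - h n / alpha n + K * t n + K * s n +
    C * eta n * (1 + delta n / alpha n).
  have [AlA AAu] := A_bounds n.
  have pE : - pairing p (u n - udag) = pairing (Estar mudag) (A (u n) - fbar).
    rewrite /p pairingNl opprK pairing_Bstar pairing_Estar -udag_sol.
    by rewrite [A (u n - udag)]linearB.
  rewrite pE -!addrA lerD2l lerD2l addrA.
  have src := source_pairing_le (f n) AlA AAu fbar mudag_ge0 (uv_sol n).1
    (eta_bound n).
  apply: (le_trans src).
  rewrite lerD2l /C -!mulrA ler_wpM2l ?addr_ge0// mulrCA ler_wpM2l//.
  have [_ JuE energy] := fin n.
  apply: growth; first by rewrite divr_ge0// ltW.
  rewrite JuE lee_fin addrC [delta n / _]mulrC.
  by apply: le_trans energy; rewrite lerDr mulr_ge0.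
(* Anything between 0 and the gap has the claimed rates. *)
have rates (E : nat -> \bar R) (d : nat -> R) : (forall n, E n = (d n)%:E) ->
    (forall n, 0 <= d n) ->
    (forall n, d n <=
       delta n / alpha n - h n / alpha n - pairing p (u n - udag)) ->
    (alpha @ \oo --> (0 : R) -> general_rate lambda alpha delta eta E) /\
    (parameter_choice lambda K alpha delta -> optimal_rate lambda delta eta E).
  move=> Ed d0 dgap.
  have d_le n := le_trans (dgap n) (gap_le n).
  split.
    exact: (bregman_general_rate lambda_ge1 (normr_ge0 _) C_ge0 alpha_gt0
      eta_ge0 eta_cvg0 t_ge0 s_ge0 th sdelta d_le Ed d0).
  exact: (bregman_optimal_rate lambda_ge1 (normr_ge0 _) C_ge0 alpha_gt0
    eta_ge0 eta_cvg0 t_ge0 s_ge0 th sdelta d_le Ed d0).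
pose b n := j n - jd - pairing p (u n - udag).
have DE n : D n = (b n)%:E.
  by rewrite /D /bregman JudagE; have [_ -> _] := fin n.
have b_ge0 n : 0 <= b n.
  have := source (u n); have [_ -> _] := fin n.
  by rewrite JudagE -EFinD lee_fin /b -addrA -opprD subr_ge0.
have b_le n : b n <= delta n / alpha n - h n / alpha n - pairing p (u n - udag).
  rewrite lerD2r; have [_ _] := fin n.
  by rewrite ![_ / alpha n]mulrC; lra.
have [general optimal] := rates _ _ DE b_ge0 b_le.
split => // e _ eP slater.
have sdn n : exists mu, nonneg_pair mu /\ (((alpha n)^-1 * h n + j n)%:E <=
    dual_objective J H (Al n) (Au n) (alpha n) (f n) mu)%E.
  have [Hv Ju _] := fin n.
  exact: (strong_duality (alpha_gt0 n) J_proper (H_proper (f n)) J_convex J_ge0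
    (H_ge0 ^~ (f n)) (H_convex (f n)) Hv Ju (uv_sol n) eP).
split=> [n|mu mu_sol p' Dsymm].
  have [mu [mu0 mu_opt]] := sdn n; exists mu; have [Hv Ju _] := fin n.
  exact: (multiplier_dual_solution (alpha_gt0 n) Hv Ju (uv_sol n)).
have mu_opt n : (((alpha n)^-1 * h n + j n)%:E <=
    dual_objective J H (Al n) (Au n) (alpha n) (f n) (mu n))%E.
  have [nu [nu0 nu_opt]] := sdn n.
  by apply: (le_trans nu_opt); have [_] := mu_sol n; exact.
have p'J n : subdifferential J (u n) (p' n).
  have [Hv Ju _] := fin n.
  by have [] := dual_optimality (alpha_gt0 n) J_proper Hv Ju (uv_sol n)
    (mu_sol n).1 (mu_opt n).
have gap n : pairing (p' n) (u n - udag) <= delta n / alpha n - h n / alpha n.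
  have [Hv Ju _] := fin n; have [AlA AAu] := A_bounds n.
  have wg : feasible (Al n) (Au n) udag fbar.
    by rewrite -udag_sol; split; [exact: AlA|exact: AAu].
  have HfE := finite_at (H_proper (f n)).1 (delta_bound n).
  have := dual_subgradient_gap (alpha_gt0 n) J_proper Hv Ju (uv_sol n)
    (mu_sol n).1 (mu_opt n) wg HfE.
  move/le_trans; apply; rewrite ![_ / alpha n]mulrC lerD2r ler_wpM2l//.
  by rewrite -lee_fin -HfE.
pose c n := pairing (p' n) (u n - udag) - pairing p (u n - udag).
have [] := rates Dsymm c.
- by move=> n.
- move=> n; have := b_ge0 n; have := p'J n udag; have [_ -> _] := fin n.
  rewrite JudagE -EFinD lee_fin -(opprB (u n) udag) pairingNr /b /c.
  by move: (pairing p _) (pairing (p' n) _) => x y; lra.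
- by move=> n; rewrite lerD2r.
- by move=> ? ?; split.
Qed.
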